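(* Let $R$ and $H$ be Leibniz conformal algebras and let $\mathfrak L$ be the associated differential graded Lie algebra $\mathfrak L(R\oplus H,H)$. Then $Z^2_{nab}(R,H)\cong MC(\mathfrak L)$: the map sending $(l,r,\chi)$ to the element $c\in\mathfrak L^1$ given by $c_\lambda((a,u),(b,v))=l(a)_\lambda v+r(b)_{-\partial-\lambda}u+\chi_\lambda(a,b)$ ($a,b\in R$, $u,v\in H$) is a bijection from $Z^2_{nab}(R,H)$ onto $MC(\mathfrak L)$.
   Context: All vector spaces are over $\mathbb C$ and all $\mathbb C[\partial]$-modules are finitely generated. A Leibniz conformal algebra is a $\mathbb C[\partial]$-module $R$ with a $\mathbb C$-bilinear $\lambda$-bracket $R\times R\to R[\lambda]$, $(a,b)\mapsto[a_\lambda b]$, such that $[(\partial a)_\lambda b]=-\lambda[a_\lambda b]$, $[a_\lambda\partial b]=(\partial+\lambda)[a_\lambda b]$ and $[a_\lambda[b_\mu c]]=[[a_\lambda b]_{\lambda+\mu}c]+[b_\mu[a_\lambda c]]$. Brackets and maps are extended linearly to polynomials in the formal variables; for $x(\lambda)=\sum_k\lambda^kx_k$, $x(-\partial-\mu)$ means $\sum_k(-\partial-\mu)^kx_k$. Cocycles. A conformal linear map $d:H\to H$ is a $\mathbb C$-linear map $d_\lambda:H\to H[\lambda]$ with $d_\lambda(\partial v)=(\partial+\lambda)d_\lambda(v)$; these form a $\mathbb C[\partial]$-module via $(\partial d)_\lambda=-\lambda d_\lambda$. $\mathrm{CDer}^L(H)$ is the set of conformal linear maps with $d_\lambda([u_\mu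 v])=[u_\mu d_\lambda(v)]+[d_\lambda(u)_{\lambda+\mu}v]$; $\mathrm{CDer}^R(H)$ is the set of those with $d_\lambda([u_\mu v])=[u_\mu d_\lambda(v)]-[v_{-\partial-\lambda-\mu}d_\lambda(u)]$. A conformal bilinear map $\chi:R\times R\to H[\lambda]$ is a $\mathbb C$-bilinear map with $\chi_\lambda(\partial a,b)=-\lambda\chi_\lambda(a,b)$, $\chi_\lambda(a,\partial b)=(\partial+\lambda)\chi_\lambda(a,b)$. A non-abelian $2$-cocycle on $R$ with values in $H$ is a triple $(l,r,\chi)$ with $\chi:R\times R\to H[\lambda]$ conformal bilinear and $l:R\to\mathrm{CDer}^L(H)$, $r:R\to\mathrm{CDer}^R(H)$ $\mathbb C[\partial]$-module homomorphisms such that for all $a,b,c\in R$, $h,h_1,h_2\in H$: (i) $[(l(a)_\lambda h_1+r(a)_\lambda h_1)_{\lambda+\mu}h_2]=0$ and $r(a)_\lambda(r(b)_\mu h+l(b)_\mu h)=0$; (ii) $l(a)_\lambda(l(b)_\mu h)-l(b)_\mu(l(a)_\lambda h)-l([a_\lambda b])_{\lambda+\mu}h=[\chi_\lambda(a,b)_{\lambda+\mu}h]$; (iii) $l(a)_\lambda(r(b)_\mu h)-r(b)_\mu(l(a)_\lambda h)-r([a_\lambda b])_{\lambda+\mu}h=[h_{-\partial-\lambda-\mu}\chi_\lambda(a,b)]$; (iv) $\chi_\lambda(a,[b_\mu c])-\chi_\mu(b,[a_\lambda c])-\chi_{\lambda+\mu}([a_\lambda b],c)+l(a)_\lambda\chi_\mu(b,c)-l(b)_\mu\chi_\lambda(a,c)-r(c)_{-\partial-\lambda-\mu}\chi_\lambda(a,b)=0$.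 $Z^2_{nab}(R,H)$ is the set of these. The differential graded Lie algebra $\mathfrak L$. For a $\mathbb C[\partial]$-module $E$, $C^n(E,E)$ ($n\ge1$) is the space of $\mathbb C$-linear maps $\gamma_{\lambda_1,\dots,\lambda_{n-1}}:E^{\otimes n}\to E[\lambda_1,\dots,\lambda_{n-1}]$ with $\gamma_{\lambda_1,\dots,\lambda_{n-1}}(a_1,\dots,\partial a_i,\dots,a_n)=-\lambda_i\gamma_{\lambda_1,\dots,\lambda_{n-1}}(a_1,\dots,a_n)$ for $i<n$ and $\gamma_{\lambda_1,\dots,\lambda_{n-1}}(a_1,\dots,\partial a_n)=(\partial+\lambda_1+\cdots+\lambda_{n-1})\gamma_{\lambda_1,\dots,\lambda_{n-1}}(a_1,\dots,a_n)$. $C^{\bullet+1}(E,E)=\bigoplus_{n\ge0}C^{n+1}(E,E)$, with $C^{n+1}(E,E)$ in degree $n$, is a graded Lie algebra under $[\gamma,\theta]=\gamma\cdot\theta-(-1)^{mn}\theta\cdot\gamma$ for $\gamma\in C^{m+1}$, $\theta\in C^{n+1}$, where $$(\gamma\cdot\theta)_{\lambda_1,\dots,\lambda_{m+n}}(a_1,\dots,a_{m+n+1})=\sum_{k=0}^m(-1)^{kn}\sum_{\sigma\in S_{(k,n)}}\mathrm{sign}(\sigma)\,\gamma_{\lambda_{\sigma(1)},\dots,\lambda_{\sigma(k)},\lambda_{\sigma(k+1)}+\cdots+\lambda_{\sigma(k+n)}+\lambda_{k+n+1},\lambda_{k+n+2},\dots,\lambda_{m+n}}\big(a_{\sigma(1)},\dots,a_{\sigma(k)},\theta_{\lambda_{\sigma(k+1)},\dots,\lambda_{\sigma(k+n)}}(a_{\sigma(k+1)},\dots,a_{\sigma(k+n)},a_{k+n+1}),a_{k+n+2},\dots,a_{m+n+1}\big),$$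 $S_{(k,n)}$ being the permutations $\sigma$ of $\{1,\dots,k+n\}$ with $\sigma(1)<\dots<\sigma(k)$ and $\sigma(k+1)<\dots<\sigma(k+n)$ (for $k=m$ the $\theta$-entry is the last argument and the subscript of $\gamma$ is just $\lambda_{\sigma(1)},\dots,\lambda_{\sigma(m)}$). Take $E=R\oplus H$ and let $\pi\in C^2(E,E)$ be the direct sum bracket $\pi_\lambda((a_1,h_1),(a_2,h_2))=([{a_1}_\lambda a_2],[{h_1}_\lambda h_2])$; then $d=[\pi,\cdot]$ is a differential. $C^{m,n}$ is the space of elements of $C^{m+n}(E,E)$ with values in $H$ which vanish on all tensor products of $m+n$ factors from $\{R,H\}$ except those with exactly $m$ factors $R$ and $n$ factors $H$. $\mathfrak L=\bigoplus_{i\ge0}\mathfrak L^i$ with $\mathfrak L^i=\bigoplus_{m+n=i+1,\,m\ge1,\,n\ge0}C^{m,n}$, a sub-differential graded Lie algebra. $MC(\mathfrak L)=\{c\in\mathfrak L^1\mid dc+\frac12[c,c]=0\}$. *)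

(* Defs.v *)
From HB Require Import structures.
From mathcomp Require Import all_boot all_order all_algebra all_fingroup.
From mathcomp Require Import finmap reals complex classical_sets functions.
From mathcomp Require Import -(notations) monalg.
From mathcomp Require Import mpoly.

Set Implicit Arguments.
Unset Strict Implicit.
Unset Printing Implicit Defensive.

Import GRing.Theory.
Local Open Scope ring_scope.

(* A C[d]-module is an lmodType over {poly C}: d acts as 'X *: _, and a complex
   scalar c acts as c%:P *: _.  Everything below is written over a field K. *)

Reserved Notation "{ 'lpoly' V [ n ] }"
  (at level 0, V, n at level 2, format "{ 'lpoly'  V [ n ] }").
Reserved Notation "x %:L" (at level 2, left associativity, format "x %:L").

(* {lpoly V[n]} is V[lambda_0, ..., lambda_(n-1)]: finitely supported families
   of elements of V indexed by the monomials in n variables, a module over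
   {mpoly A[n]}.  For A = {poly K} this ring is K[d][lambda_0, ..., lambda_(n-1)],
   where d is the scalar 'X%:MP and acts on the coefficients. *)
Definition lpoly (A : comNzRingType) (n : nat) (V : lmodType A) :=
  monalg.malg 'X_{1..n} V.

Notation "{ 'lpoly' V [ n ] }" := (@lpoly _ n V) : type_scope.

Section Coefficients.
Variables (A : comNzRingType) (n : nat) (V : lmodType A).

HB.instance Definition _ :=
  GRing.Zmodule.copy (@lpoly A n V) (monalg.malg 'X_{1..n} V).

Definition lcoef (k : 'X_{1..n}) (x : {lpoly V[n]}) : V := monalg.mcoeff k x.
Definition lmon (k : 'X_{1..n}) (v : V) : {lpoly V[n]} := monalg.mkmalgU k v.
Definition lsupp (x : {lpoly V[n]}) : {fset 'X_{1..n}} := monalg.msupp x.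

End Coefficients.

HB.lock Definition lscale (A : comNzRingType) (n : nat) (V : lmodType A)
    (p : {mpoly A[n]}) (x : {lpoly V[n]}) : {lpoly V[n]} :=
  \sum_(i <- msupp p) \sum_(j <- lsupp x) lmon (i + j)%MM (p@_i *: lcoef j x).

Section FormalPolynomials.
Variable A : comNzRingType.
Implicit Types (n : nat) (V : lmodType A).

Section Module.
Variables (n : nat) (V : lmodType A).
Implicit Types (p q : {mpoly A[n]}) (x y : {lpoly V[n]}).
Implicit Types (k : 'X_{1..n}) (v : V).

Lemma lmonD k : {morph @lmon A n V k : u v / u + v}.
Proof. exact: monalg.monalgUD. Qed.

Lemma lmon0 k : @lmon A n V k 0 = 0.
Proof. exact: monalg.monalgU0. Qed.

Lemma lpolyE x : x = \sum_(k <- lsupp x) lmon k (lcoef k x).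
Proof. exact: monalg.monalgE. Qed.

Lemma lcoefD k : {morph @lcoef A n V k : x y / x + y}.
Proof. exact: monalg.mcoeffD. Qed.

Lemma lsum_wide (W : zmodType) (f : 'X_{1..n} -> V -> W) x (D : {fset 'X_{1..n}}) :
  (forall k, f k 0 = 0) -> (lsupp x `<=` D)%fset ->
  \sum_(k <- lsupp x) f k (lcoef k x) = \sum_(k <- D) f k (lcoef k x).
Proof.
move=> f0 sD; rewrite (big_fset_incl _ sD) // => k kD kx.
by rewrite /lcoef monalg.mcoeff_outdom ?f0.
Qed.

Lemma lsumD (W : zmodType) (f : 'X_{1..n} -> V -> W) x y :
  (forall k, {morph f k : u v / u + v}) ->
  \sum_(k <- lsupp (x + y)) f k (lcoef k (x + y)) =
  \sum_(k <- lsupp x) f k (lcoef k x) + \sum_(k <- lsupp y) f k (lcoef k y).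
Proof.
move=> fD; have f0 k : f k 0 = 0 by apply: (@addrI _ (f k 0)); rewrite -fD !addr0.
pose D := (lsupp x `|` lsupp y)%fset.
rewrite (@lsum_wide _ _ (x + y) D) ?(@lsum_wide _ _ x D) ?(@lsum_wide _ _ y D) //.
- by rewrite -big_split; apply: eq_bigr => k _; rewrite lcoefD fD.
- exact: fsubsetUr.
- exact: fsubsetUl.
- exact: monalg.msuppD_le.
Qed.

Lemma lsum_mon (W : zmodType) (f : 'X_{1..n} -> V -> W) k v :
  (forall i, f i 0 = 0) ->
  \sum_(i <- lsupp (lmon k v)) f i (lcoef i (lmon k v)) = f k v.
Proof.
move=> f0; rewrite (@lsum_wide _ _ _ [fset k]%fset) //; last exact: monalg.msuppU_le.
by rewrite big_seq_fset1 /lcoef monalg.mcoeffUU.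
Qed.

Lemma lpoly_ind (P : {lpoly V[n]} -> Prop) :
  P 0 -> (forall k v x, P x -> P (lmon k v + x)) -> forall x, P x.
Proof.
move=> P0 PD x; rewrite (lpolyE x); elim/big_rec: _ => // k y _; exact: PD.
Qed.

Lemma lscaleDr p : {morph @lscale A n V p : x y / x + y}.
Proof.
move=> x y; rewrite lscale.unlock -big_split; apply: eq_bigr => i _ /=.
rewrite (@lsumD _ (fun j u => lmon (i + j)%MM (p@_i *: u))) // => k u v.
by rewrite scalerDr lmonD.
Qed.

Lemma lscale_mon p k v :
  @lscale A n V p (lmon k v) = \sum_(i <- msupp p) lmon (i + k)%MM (p@_i *: v).
Proof.
rewrite lscale.unlock; apply: eq_bigr => i _.
rewrite (@lsum_mon _ (fun j u => lmon (i + j)%MM (p@_i *: u))) //.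
by move=> j; rewrite scaler0 lmon0.
Qed.

Lemma lscale0 p : @lscale A n V p 0 = 0.
Proof. by apply: (@addrI _ (lscale p 0)); rewrite -lscaleDr !addr0. Qed.

Lemma lscaleDl p q x : lscale (p + q) x = lscale p x + lscale q x.
Proof.
elim/lpoly_ind: x => [|k v x IH]; first by rewrite !lscale0 addr0.
rewrite !lscaleDr IH addrACA; congr (_ + _); rewrite !lscale_mon.
pose s := undup (msupp (p + q) ++ msupp p ++ msupp q).
have wide (r : {mpoly A[n]}) : {subset msupp r <= s} ->
    \sum_(i <- msupp r) lmon (i + k)%MM (r@_i *: v) =
    \sum_(i <- s) lmon (i + k)%MM (r@_i *: v).
  move=> rs; rewrite [RHS](bigID (mem (msupp r))) /= [X in _ = _ + X]big1 ?addr0.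
    rewrite -[RHS]big_filter; apply/perm_big/uniq_perm => //.
      by rewrite filter_uniq // undup_uniq.
    by move=> i; rewrite mem_filter; case: (boolP (i \in msupp r)) => // /rs ->.
  by move=> i /memN_msupp_eq0 ->; rewrite scale0r lmon0.
rewrite !wide ?big_split /=; first last.
- by move=> i ip; rewrite mem_undup mem_cat ip.
- by move=> i ip; rewrite mem_undup !mem_cat ip orbT.
- by move=> i ip; rewrite mem_undup !mem_cat ip !orbT.
by rewrite -big_split; apply: eq_bigr => i _; rewrite mcoeffD scalerDl lmonD.
Qed.

Lemma lscale0l x : lscale 0 x = 0.
Proof. by apply: (@addrI _ (lscale 0 x)); rewrite -lscaleDl !addr0. Qed.

Lemma lscaleX c i k v :
  lscale (c *: 'X_[i]) (lmon k v) = lmon (i + k)%MM (c *: v).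
Proof.
rewrite lscale_mon; have [->|c0] := eqVneq c 0.
  by rewrite scale0r msupp0 big_nil scale0r lmon0.
by rewrite msuppMCX // big_seq1 mcoeffZ mcoeffX eqxx mulr1.
Qed.

Lemma lscale1 : left_id 1 (@lscale A n V).
Proof.
move=> x; elim/lpoly_ind: x => [|k v x IH]; first exact: lscale0.
rewrite lscaleDr IH; congr (_ + _).
by rewrite -mpolyX0 -[X in lscale X _]scale1r lscaleX add0m scale1r.
Qed.

Lemma lscaleA p q x : lscale p (lscale q x) = lscale (p * q) x.
Proof.
elim/lpoly_ind: x => [|k v x IH]; first by rewrite (lscale0 q) (lscale0 p) lscale0.
rewrite (lscaleDr q) (lscaleDr p) (lscaleDr (p * q)) {}IH; congr (_ + _).
elim/mpolyind: q => [|c m q _ _ IHq].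
  by rewrite mulr0 (lscale0l (lmon k v)) lscale0.
rewrite mulrDr (lscaleDl _ q) (lscaleDl _ (p * q)) (lscaleDr p) {}IHq; congr (_ + _).
rewrite lscaleX.
elim/mpolyind: p => [|b j p _ _ IHp]; first by rewrite mul0r [LHS]lscale0l [RHS]lscale0l.
have E : lscale (b *: 'X_[j]) (lmon (m + k)%MM (c *: v)) =
         lscale ((b *: 'X_[j]) * (c *: 'X_[m])) (lmon k v).
  by rewrite -scalerAl -scalerAr !scalerA -mpolyXD !lscaleX scalerA addmA.
by rewrite mulrDl lscaleDl [RHS]lscaleDl IHp E.
Qed.

End Module.

HB.instance Definition _ n V := GRing.Zmodule_isLmodule.Build
  {mpoly A[n]} (@lpoly A n V) (@lscaleA n V) (@lscale1 n V)
  (@lscaleDr n V) (fun x p q => @lscaleDl n V p q x).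

Definition lconst n V (v : V) : {lpoly V[n]} := lmon 0%MM v.

End FormalPolynomials.

Notation "x %:L" := (lconst _ x) : ring_scope.

Section Substitution.
Variable K : fieldType.

(* The variable lambda_i, with i a natural number (0 if i >= n). *)
Definition lvar n (i : nat) : {mpoly {poly K}[n]} :=
  if insub i is Some j then 'X_(j : 'I_n) else 0.

Definition ddel n : {mpoly {poly K}[n]} := ('X : {poly K})%:MP.

Definition lcst n (c : K) : {mpoly {poly K}[n]} := (c%:P)%:MP.

(* x(p_0, ..., p_(m-1)): each monomial lambda^k x_k becomes p^k x_k, where the
   d's occurring in p act on x_k. *)
Definition lsubst m n (V : lmodType {poly K}) (p : 'I_m -> {mpoly {poly K}[n]})
    (x : {lpoly V[m]}) : {lpoly V[n]} :=
  \sum_(k <- lsupp x) mmap1 p k *: lconst n (lcoef k x).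

(* Extension of a map to polynomials in the formal variables:
   sum_k lambda^k x_k is sent to sum_k lambda^k f(x_k). *)
Definition lext n (V W : lmodType {poly K}) (f : V -> {lpoly W[n]})
    (x : {lpoly V[n]}) : {lpoly W[n]} :=
  \sum_(k <- lsupp x) 'X_[k] *: f (lcoef k x).

Definition lmap n (V W : lmodType {poly K}) (f : V -> W) (x : {lpoly V[n]}) :
    {lpoly W[n]} := lext (fun v => lconst n (f v)) x.

(* at1 d p x is d_p(x) and at2 B p x y is B_p(x, y); x and y may be polynomials
   in the formal variables.  The d's in p act on the coefficients of the value
   of d or B. *)
Definition at1 n (V W : lmodType {poly K}) (d : V -> {lpoly W[1]})
    (p : {mpoly {poly K}[n]}) (x : {lpoly V[n]}) : {lpoly W[n]} :=
  lext (fun v => lsubst (fun _ => p) (d v)) x.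

Definition at2 n (U V W : lmodType {poly K}) (B : U -> V -> {lpoly W[1]})
    (p : {mpoly {poly K}[n]}) (x : {lpoly U[n]}) (y : {lpoly V[n]}) : {lpoly W[n]} :=
  lext (fun u => at1 (B u) p y) x.

End Substitution.

Section LeibnizConformal.
Variable K : fieldType.

Local Notation lam1 := (lvar K 1 0).
Local Notation del1 := (ddel K 1).
Local Notation lam := (lvar K 2 0).
Local Notation mu := (lvar K 2 1).
Local Notation del := (ddel K 2).

Definition finitely_generated (M : lmodType {poly K}) :=
  exists s : seq M, forall v : M,
  exists c : nat -> {poly K}, v = \sum_(i < size s) c i *: s`_i.

Definition klinear n (V W : lmodType {poly K}) (f : V -> {lpoly W[n]}) :=
  forall (c : K) u v, f (c%:P *: u + v) = lcst n c *: f u + f v.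

Definition conformal_linear (V W : lmodType {poly K}) (d : V -> {lpoly W[1]}) :=
  klinear d /\ forall v, d ('X *: v) = (del1 + lam1) *: d v.

Definition conformal_bilinear (U V W : lmodType {poly K})
    (B : U -> V -> {lpoly W[1]}) :=
  [/\ forall b, klinear (fun a => B a b),
      forall a, klinear (B a),
      forall a b, B ('X *: a) b = - lam1 *: B a b
    & forall a b, B a ('X *: b) = (del1 + lam1) *: B a b].

Definition leibniz_identity (R : lmodType {poly K}) (br : R -> R -> {lpoly R[1]}) :=
  forall a b c : R,
    at2 br lam a%:L (at2 br mu b%:L c%:L) =
    at2 br (lam + mu) (at2 br lam a%:L b%:L) c%:L +
    at2 br mu b%:L (at2 br lam a%:L c%:L).

Record leibnizConformalAlgebra := LeibnizConformalAlgebra {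
  lca_sort :> lmodType {poly K};
  lbr : lca_sort -> lca_sort -> {lpoly lca_sort[1]};
  lbr_conformal : conformal_bilinear lbr;
  lbr_leibniz : leibniz_identity lbr }.

Section Cocycles.
Variables R H : leibnizConformalAlgebra.

Definition CDerL (d : H -> {lpoly H[1]}) :=
  conformal_linear d /\
  forall u v : H,
    at1 d lam (at2 (@lbr H) mu u%:L v%:L) =
    at2 (@lbr H) mu u%:L (at1 d lam v%:L) +
    at2 (@lbr H) (lam + mu) (at1 d lam u%:L) v%:L.

Definition CDerR (d : H -> {lpoly H[1]}) :=
  conformal_linear d /\
  forall u v : H,
    at1 d lam (at2 (@lbr H) mu u%:L v%:L) =
    at2 (@lbr H) mu u%:L (at1 d lam v%:L) -
    at2 (@lbr H) (- del - lam - mu) v%:L (at1 d lam u%:L).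

(* K[d]-module homomorphism from R to the conformal linear maps of H, on which
   d acts by (d f)_lambda = - lambda f_lambda. *)
Definition hom_to_conformal_maps (f : R -> H -> {lpoly H[1]}) :=
  (forall (c : K) a b h, f (c%:P *: a + b) h = lcst 1 c *: f a h + f b h) /\
  (forall a h, f ('X *: a) h = - lam1 *: f a h).

Record cocycle_data := CocycleData {
  cl : R -> H -> {lpoly H[1]};
  cr : R -> H -> {lpoly H[1]};
  cchi : R -> R -> {lpoly H[1]} }.

Record nonabelian_cocycle (z : cocycle_data) : Prop := NonabelianCocycle {
  coc_chi : conformal_bilinear (cchi z);
  coc_l : (forall a, CDerL (cl z a)) /\ hom_to_conformal_maps (cl z);
  coc_r : (forall a, CDerR (cr z a)) /\ hom_to_conformal_maps (cr z);
  coc_i1 : forall (a : R) (h1 h2 : H),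
    at2 (@lbr H) (lam + mu)
      (at2 (cl z) lam a%:L h1%:L + at2 (cr z) lam a%:L h1%:L) h2%:L = 0;
  coc_i2 : forall (a b : R) (h : H),
    at2 (cr z) lam a%:L
      (at2 (cr z) mu b%:L h%:L + at2 (cl z) mu b%:L h%:L) = 0;
  coc_ii : forall (a b : R) (h : H),
    at2 (cl z) lam a%:L (at2 (cl z) mu b%:L h%:L) -
    at2 (cl z) mu b%:L (at2 (cl z) lam a%:L h%:L) -
    at2 (cl z) (lam + mu) (at2 (@lbr R) lam a%:L b%:L) h%:L =
    at2 (@lbr H) (lam + mu) (at2 (cchi z) lam a%:L b%:L) h%:L;
  coc_iii : forall (a b : R) (h : H),
    at2 (cl z) lam a%:L (at2 (cr z) mu b%:L h%:L) -
    at2 (cr z) mu b%:L (at2 (cl z) lam a%:L h%:L) -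
    at2 (cr z) (lam + mu) (at2 (@lbr R) lam a%:L b%:L) h%:L =
    at2 (@lbr H) (- del - lam - mu) h%:L (at2 (cchi z) lam a%:L b%:L);
  coc_iv : forall a b c : R,
    at2 (cchi z) lam a%:L (at2 (@lbr R) mu b%:L c%:L) -
    at2 (cchi z) mu b%:L (at2 (@lbr R) lam a%:L c%:L) -
    at2 (cchi z) (lam + mu) (at2 (@lbr R) lam a%:L b%:L) c%:L +
    at2 (cl z) lam a%:L (at2 (cchi z) mu b%:L c%:L) -
    at2 (cl z) mu b%:L (at2 (cchi z) lam a%:L c%:L) -
    at2 (cr z) (- del - lam - mu) c%:L (at2 (cchi z) lam a%:L b%:L) = 0 }.

Definition Z2nab : set cocycle_data := nonabelian_cocycle.

End Cocycles.

(* Maps out of the (n+1)-fold tensor product over K are encoded as multilinear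
   maps; an element of C^(n+1)(E, E), of degree n, is a map of the type cochain
   satisfying is_cochain. *)
Definition cochain (E : lmodType {poly K}) n :=
  {ffun 'I_n.+1 -> E} -> {lpoly E[n]}.

Section Graded.
Variable E : lmodType {poly K}.

Definition set_arg n (a : {ffun 'I_n.+1 -> E}) (i : 'I_n.+1) (x : E) :
    {ffun 'I_n.+1 -> E} := [ffun j => if j == i then x else a j].

Definition is_cochain n (g : cochain E n) :=
  [/\ forall a i, klinear (fun x => g (set_arg a i x)),
      forall a (i : 'I_n.+1), (i < n)%N ->
        g (set_arg a i ('X *: a i)) = - lvar K n i *: g a
    & forall a, g (set_arg a ord_max ('X *: a ord_max)) =
        (ddel K n + \sum_(i < n) lvar K n i) *: g a].

(* A permutation of {0, ..., p-1} as a map on nat, fixing every i >= p. *)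
Definition perm_nat p (s : 'S_p) (i : nat) : nat :=
  if insub i is Some j then s (j : 'I_p) else i.

Definition is_shuffle k n (s : 'S_(k + n)) :=
  [forall i : 'I_(k + n), forall j : 'I_(k + n),
     (i < j)%N && ((j < k)%N || (k <= i)%N) ==> (s i < s j)%N].

(* The product of g (of degree m) and t (of degree n), meaningful for
   N = m + n; N is a separate parameter so that both products occurring in the
   Lie bracket have the same type.  Arguments and variables are numbered from 0. *)
Definition graded_prod N m n (g : cochain E m) (t : cochain E n) : cochain E N :=
  fun a =>
  \sum_(k < m.+1) (-1) ^+ (k * n) *:
  \sum_(s : 'S_(k + n) | is_shuffle s) (-1) ^+ odd_perm s *:
    lext
      (fun w => lsubst
         (fun i : 'I_m =>
            if (i < k)%N then lvar K N (perm_nat s i)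
            else if i == k :> nat then
              \sum_(j < n) lvar K N (perm_nat s (k + j)%N) + lvar K N (k + n)%N
            else lvar K N (i + n)%N)
         (g [ffun i : 'I_m.+1 =>
               if (i < k)%N then a (inord (perm_nat s i))
               else if i == k :> nat then w
               else a (inord (i + n)%N)]))
      (lsubst
         (fun j : 'I_n => lvar K N (perm_nat s (k + j)%N))
         (t [ffun j : 'I_n.+1 =>
               if (j < n)%N then a (inord (perm_nat s (k + j)%N))
               else a (inord (k + n)%N)])).

Definition cbracket m n (g : cochain E m) (t : cochain E n) : cochain E (m + n) :=
  fun a => graded_prod g t a - (-1) ^+ (m * n) *: graded_prod t g a.

End Graded.

Section MaurerCartan.
Variables R H : leibnizConformalAlgebra.

Local Notation E := (R * H)%type.

Definition inlR n : {lpoly R[n]} -> {lpoly E[n]} := lmap (fun a : R => (a, 0) : E).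
Definition inrH n : {lpoly H[n]} -> {lpoly E[n]} := lmap (fun h : H => (0, h) : E).

Definition direct_sum_bracket : cochain E 1 := fun a =>
  inlR (lbr (a ord0).1 (a ord_max).1) + inrH (lbr (a ord0).2 (a ord_max).2).

Definition dcochain n (g : cochain E n) : cochain E (1 + n) :=
  cbracket direct_sum_bracket g.

(* S is the set of positions of the factors taken in R. *)
Definition in_Cmn N (m n : nat) (g : cochain E N) :=
  [/\ (m + n)%N = N.+1,
      is_cochain g,
      forall a k, (lcoef k (g a)).1 = 0
    & forall (S : {set 'I_N.+1}) (a : {ffun 'I_N.+1 -> E}),
        (forall i, i \in S -> (a i).2 = 0) ->
        (forall i, i \notin S -> (a i).1 = 0) ->
        #|S| != m -> g a = 0].

(* Membership in L^i, the sum inside C^(i+1)(E, E) of the spaces C^(m,n) with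
   m + n = i + 1 and m >= 1. *)
Definition in_L i (g : cochain E i) :=
  exists f : nat -> cochain E i,
    (forall m, (1 <= m <= i.+1)%N -> in_Cmn m (i.+1 - m) (f m)) /\
    forall a, g a = \sum_(1 <= m < i.+2) f m a.

Definition MC : set (cochain E 1) := fun c =>
  in_L c /\
  forall a, dcochain c a + lcst (1 + 1) 2%:R^-1 *: cbracket c c a = 0.

Definition cocycle_to_MC (z : cocycle_data R H) : cochain E 1 := fun x =>
  let: (a, u) := x ord0 in
  let: (b, v) := x ord_max in
  inrH (cl z a v + lsubst (fun _ => - del1 - lam1) (cr z b u) + cchi z a b).

End MaurerCartan.

End LeibnizConformal.

(* Main.v *)
Require Import Defs.
From HB Require Import structures.
From mathcomp Require Import all_boot all_order all_algebra all_fingroup.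
From mathcomp Require Import finmap boolp reals complex classical_sets functions.
From mathcomp Require Import mpoly ring.

(* With pi the direct sum bracket, d c + [c,c]/2 = pi.c + c.pi + c.c, and g.t is
   the defect of the Leibniz identity with outer bracket g and inner bracket t.
   This expression is additive in its three arguments, so it vanishes if and only
   if it vanishes when each of them lies in R or in H.  The case HHH is void; in
   the other seven c is built from the bilinear maps l, chi and
   (u, b) |-> r(b)_(-d-lambda) u.  RRR, RRH and RHH are (iv), (ii) and the
   condition that l(a) lies in CDer^L; RHR and HHR become (iii) and the condition
   that r(a) lies in CDer^R after an invertible substitution of the variables
   (lambda, mu).  Modulo RHR and RHH, the cases HRR and HRH become the two
   equations of (i). *)

Set Implicit Arguments.
Unset Strict Implicit.
Unset Printing Implicit Defensive.

Import GRing.Theory.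
Local Open Scope ring_scope.

(** Since pi.pi = 0 by the Leibniz identities of R and H, the expression equals (pi + c).(pi + c): a
    Maurer-Cartan element is a c for which pi + c is again a Leibniz conformal bracket on the direct
    sum, that of a non-abelian extension. The obstacle is that d in a subscript is not a scalar: it
    acts on the value of the map carrying that subscript. Inside an outer map with subscript p, the
    d of an inner subscript acts as -p (left argument) or as d + p (right argument), so two nested
    terms may agree although their inner subscripts differ as polynomials. Hence substitution for
    the variables and substitution for d are kept as two ring morphisms, [psubst] and [dsubst], and
    nested terms are compared through polynomial identities in d, lambda, mu. The parameters lambda,
    mu and -d-lambda-mu have sum -d, and the substitutions used permute them; this is why they are
    invertible. The cases HRH and HRR repeat RHH and RHR with the first two arguments exchanged, r
    replacing l up to sign. Adding the two leaves only l + r, which is where (i) comes from. *)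

(* lsub, lex, lcon, and later lat2 and lmp, are sealed copies: unification would
   otherwise unfold the originals whenever two of their instances fail to match,
   which does not terminate in practice. *)
HB.lock Definition lsub := @lsubst.
HB.lock Definition lex := @lext.
HB.lock Definition lcon := @lconst.
Arguments lcon {A n V} _.
Notation "x %:l" := (lcon x) (at level 2, left associativity, format "x %:l").

(** * Substitution in formal polynomials *)

Section FormalPolynomials.
Variable K : fieldType.
Local Notation A := {poly K}.

Section Module.
Variables (n : nat) (V : lmodType A).
Implicit Types (x y : {lpoly V[n]}) (v : V) (k : 'X_{1..n}).

Lemma lconD : {morph @lcon A n V : u v / u + v}.
Proof. by rewrite lcon.unlock; apply: lmonD. Qed.

Lemma lcon0 : @lcon A n V 0 = 0.
Proof. by rewrite lcon.unlock; apply: lmon0. Qed.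

Lemma scale_lmon (c : A) i k v :
  (c *: 'X_[i] : {mpoly A[n]}) *: lmon k v = lmon (i + k)%MM (c *: v).
Proof. exact: lscaleX. Qed.

Lemma lmonE k v : lmon k v = 'X_[k] *: (v%:l : {lpoly V[n]}).
Proof. by rewrite lcon.unlock -['X_[k]]scale1r scale_lmon addm0 scale1r. Qed.

Lemma lconE v : v%:l = lmon 0%MM v :> {lpoly V[n]}.
Proof. by rewrite lcon.unlock. Qed.

Lemma lconZ (c : A) v : (c *: v)%:l = c%:MP *: (v%:l : {lpoly V[n]}).
Proof. by rewrite !lconE -[c%:MP]mulr1 mul_mpolyC -mpolyX0 scale_lmon add0m. Qed.

(** Additive maps that commute with the variables are determined by their values on constants. Most
    identities below are proved in this way, without handling monomials. *)
Lemma lpoly_gen_ind (P : {lpoly V[n]} -> Prop) :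
  (forall v, P v%:l) -> (forall i x, P x -> P ('X_i *: x)) ->
  (forall x y, P x -> P y -> P (x + y)) -> forall x, P x.
Proof.
move=> PC PX PD; apply: lpoly_ind => [|k v x]; first by rewrite -lcon0.
apply: PD; rewrite lmonE mpolyXE_id.
elim/big_rec: _ => [|i p _ IH]; first by rewrite scale1r.
rewrite -scalerA; elim: (k i) => [|j IHj]; first by rewrite expr0 scale1r.
by rewrite exprS -scalerA; apply: PX.
Qed.

End Module.

Lemma lvarE n (i : 'I_n) : lvar K n i = 'X_i.
Proof. by rewrite /lvar valK. Qed.

Section Subst.
Variables (m n : nat) (s : 'I_m -> {mpoly A[n]}).

(** The morphism of K[d]-algebras along which [lsub s] is semilinear; it fixes d. *)
Definition psubst : {mpoly A[m]} -> {mpoly A[n]} := mmap (@mpolyC n A) s.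

HB.instance Definition _ := GRing.RMorphism.copy psubst (mmap (@mpolyC n A) s).

Lemma psubstX i : psubst 'X_i = s i.
Proof. by rewrite /psubst mmapX mmap1U. Qed.

Lemma psubstC c : psubst c%:MP = c%:MP.
Proof. by rewrite /psubst mmapC. Qed.

Variable V : lmodType A.
Implicit Types x y : {lpoly V[m]}.

Lemma lsubD : {morph @lsub K m n V s : x y / x + y}.
Proof.
move=> x y; rewrite lsub.unlock /lsubst -lcon.unlock
  (@lsumD _ _ _ _ (fun k v => mmap1 s k *: v%:l)) // => k u v.
by rewrite lconD scalerDr.
Qed.

Lemma lsub_lmon k (v : V) : lsub s (lmon k v) = mmap1 s k *: v%:l.
Proof.
by rewrite lsub.unlock /lsubst -lcon.unlock
  (@lsum_mon _ _ _ _ (fun k v => mmap1 s k *: v%:l)) // => i;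
   rewrite lcon0 scaler0.
Qed.

Lemma lsubC (v : V) : lsub s v%:l = v%:l.
Proof. by rewrite [in LHS]lconE lsub_lmon mmap11 scale1r. Qed.

Lemma lsub0 : lsub s (0 : {lpoly V[m]}) = 0.
Proof. by rewrite -(lcon0 m V) lsubC lcon0. Qed.

Lemma lsubZ q x : lsub s (q *: x) = psubst q *: lsub s x.
Proof.
elim/mpolyind: q => [|c i q _ _ IHq]; first by rewrite raddf0 !scale0r lsub0.
rewrite raddfD /= !scalerDl lsubD IHq; congr (_ + _).
elim/lpoly_ind: x {IHq} => [|k v x IH]; first by rewrite scaler0 lsub0 scaler0.
rewrite scalerDr !lsubD scalerDr IH; congr (_ + _).
rewrite scale_lmon; apply: etrans (lsub_lmon _ _) _.
rewrite lsub_lmon /psubst mmapZ mmapX lconZ commr_mmap1_M; last first.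
  by move=> *; apply: mulrC.
by rewrite !scalerA; congr (_ *: _); rewrite mulrC; ring.
Qed.

Lemma lsubN x : lsub s (- x) = - lsub s x.
Proof. by rewrite -scaleN1r lsubZ rmorphN1 scaleN1r. Qed.

Lemma lsubB x y : lsub s (x - y) = lsub s x - lsub s y.
Proof. by rewrite lsubD lsubN. Qed.

End Subst.

Lemma eq_lsub m n (V : lmodType A) (s t : 'I_m -> {mpoly A[n]}) :
  s =1 t -> @lsub K m n V s =1 lsub t.
Proof.
move=> st x; elim/lpoly_gen_ind: x => [v|i x IH|x y IHx IHy].
- by rewrite !lsubC.
- by rewrite !lsubZ IH !psubstX st.
- by rewrite !lsubD IHx IHy.
Qed.

Lemma lsub_comp m n p (V : lmodType A) (s : 'I_n -> {mpoly A[p]})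
    (t : 'I_m -> {mpoly A[n]}) (x : {lpoly V[m]}) :
  lsub s (lsub t x) = lsub (fun i => psubst s (t i)) x.
Proof.
elim/lpoly_gen_ind: x => [v|i x IH|x y IHx IHy].
- by rewrite !lsubC.
- by rewrite !lsubZ IH !psubstX.
- by rewrite !lsubD IHx IHy.
Qed.

Lemma lsub_id n (V : lmodType A) (s : 'I_n -> {mpoly A[n]}) (x : {lpoly V[n]}) :
  (forall i, s i = 'X_i) -> lsub s x = x.
Proof.
move=> sE; elim/lpoly_gen_ind: x => [v|i x IH|x y IHx IHy].
- by rewrite !lsubC.
- by rewrite !lsubZ IH !psubstX sE.
- by rewrite !lsubD IHx IHy.
Qed.

(* The endomorphism of K[d][lambda] sending d to q and fixing the lambda_i. *)
Section DSubst.
Variables (n : nat) (q : {mpoly A[n]}).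

Definition dhorner : A -> {mpoly A[n]} :=
  horner_morph (fun c => mulrC q ((@mpolyC n A \o polyC) c)).
HB.instance Definition _ := GRing.RMorphism.on dhorner.

Definition dsubst : {mpoly A[n]} -> {mpoly A[n]} := mmap dhorner (fun i => 'X_i).
HB.instance Definition _ :=
  GRing.RMorphism.copy dsubst (mmap dhorner (fun i => 'X_i)).

Lemma dsubstX i : dsubst 'X_i = 'X_i.
Proof. by rewrite /dsubst mmapX mmap1U. Qed.

Lemma dsubst_ddel : dsubst (ddel K n) = q.
Proof. by rewrite /dsubst mmapC /= /dhorner horner_morphX. Qed.

Lemma dsubst_lcst c : dsubst (lcst n c) = lcst n c.
Proof. by rewrite /dsubst mmapC /= /dhorner horner_morphC. Qed.

Lemma dsubst_lvar i : dsubst (lvar K n i) = lvar K n i.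
Proof. by rewrite /lvar; case: insub => [j|]; rewrite ?dsubstX ?raddf0. Qed.

End DSubst.

(** * Extension of K-linear maps to formal polynomials *)

Section Klinear.
Variables (n : nat) (V W : lmodType A) (f : V -> {lpoly W[n]}).
Hypothesis fL : klinear f.

Lemma lcst1 : lcst n (1 : K) = 1.
Proof. by rewrite /lcst -mpolyC1. Qed.

Lemma klinearD : {morph f : u v / u + v}.
Proof. by move=> u v; have := fL 1 u v; rewrite lcst1 !scale1r. Qed.

Lemma klinear0 : f 0 = 0.
Proof. by apply: (@addrI _ (f 0)); rewrite -klinearD !addr0. Qed.

Lemma klinearZ (c : K) u : f (c%:P *: u) = lcst n c *: f u.
Proof. by have := fL c u 0; rewrite klinear0 !addr0. Qed.

Lemma lexD : {morph lex f : x y / x + y}.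
Proof.
move=> x y; rewrite lex.unlock /lext
  (@lsumD _ _ _ _ (fun k v => 'X_[k] *: f v)) // => k u v.
by rewrite klinearD scalerDr.
Qed.

Lemma lex_lmon k v : lex f (lmon k v) = 'X_[k] *: f v.
Proof.
by rewrite lex.unlock /lext (@lsum_mon _ _ _ _ (fun k v => 'X_[k] *: f v)) // => i;
   rewrite klinear0 scaler0.
Qed.

Lemma lexC v : lex f v%:l = f v.
Proof. by rewrite lconE lex_lmon mpolyX0 scale1r. Qed.

Lemma lex0 : lex f 0 = 0.
Proof. by rewrite -(lcon0 n V) lexC klinear0. Qed.

Lemma lexX i x : lex f ('X_i *: x) = 'X_i *: lex f x.
Proof.
elim/lpoly_ind: x => [|k v x IH]; first by rewrite scaler0 lex0 scaler0.
rewrite scalerDr !lexD scalerDr IH; congr (_ + _);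
rewrite -['X_i in LHS]scale1r scale_lmon scale1r.
by apply: etrans (lex_lmon _ _) _; rewrite lex_lmon mpolyXD scalerA.
Qed.

Lemma lex_lcst c x : lex f (lcst n c *: x) = lcst n c *: lex f x.
Proof.
elim/lpoly_gen_ind: x => [v|i x IH|x y IHx IHy].
- by rewrite -lconZ !lexC klinearZ.
- by rewrite scalerA mulrC -scalerA !lexX IH !scalerA mulrC.
- by rewrite scalerDr !lexD IHx IHy scalerDr.
Qed.

(** A K-linear [f] need not commute with d. If it turns d into [q], its extension is semilinear
    along [dsubst q]; this is checked on d, then on K[d], then on monomials. *)
Lemma lex_scale q p x : (forall v, f ('X *: v) = q *: f v) ->
  lex f (p *: x) = dsubst q p *: lex f x.
Proof.
move=> fX.
have lextd y : lex f (ddel K n *: y) = q *: lex f y.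
  elim/lpoly_gen_ind: y => [v|i y IH|y z IHy IHz].
  - by rewrite -lconZ !lexC fX.
  - by rewrite scalerA mulrC -scalerA !lexX IH !scalerA mulrC.
  - by rewrite scalerDr !lexD IHy IHz scalerDr.
have lextA c y : lex f ((c%:MP : {mpoly A[n]}) *: y) = dsubst q c%:MP *: lex f y.
  elim/poly_ind: c y => [|c a IH] y; first by rewrite mpolyC0 rmorph0 !scale0r lex0.
  rewrite mpolyCD mpolyCM rmorphD rmorphM /= !scalerDl lexD -!scalerA IH lextd.
  by rewrite -/(lcst n a) lex_lcst dsubst_lcst -/(ddel K n) dsubst_ddel.
elim/mpolyind: p x => [|c i p _ _ IHp] x; first by rewrite raddf0 !scale0r lex0.
rewrite raddfD /= !scalerDl lexD IHp; congr (_ + _).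
rewrite -mul_mpolyC rmorphM /= -!scalerA lextA; congr (_ *: _).
rewrite mpolyXE_id rmorph_prod /=.
elim/big_rec2: _ x => [|j p1 p2 _ IH] x; first by rewrite !scale1r.
rewrite -!scalerA rmorphXn /= dsubstX -IH.
elim: (i j) => [|k IHk]; first by rewrite !expr0 !scale1r.
by rewrite !exprS -!scalerA lexX IHk.
Qed.

End Klinear.

Lemma eq_lex n (V W : lmodType A) (f g : V -> {lpoly W[n]}) :
  f =1 g -> lex f =1 lex g.
Proof. by move=> fg x; rewrite lex.unlock /lext; apply: eq_bigr => k _; rewrite fg. Qed.

End FormalPolynomials.

(** * Conformal bilinear maps *)

HB.lock Definition lat2 := @at2.
HB.lock Definition lmp := @lmap.

Section Bilinear.
Variable K : fieldType.
Local Notation A := {poly K}.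

Lemma psubst_ddel m n (s : 'I_m -> {mpoly A[n]}) : psubst s (ddel K m) = ddel K n.
Proof. exact: psubstC. Qed.

Lemma psubst_lcst m n (s : 'I_m -> {mpoly A[n]}) c : psubst s (lcst m c) = lcst n c.
Proof. exact: psubstC. Qed.

Lemma psubst_lvar m n (s : 'I_m -> {mpoly A[n]}) (i : 'I_m) :
  psubst s (lvar K m i) = s i.
Proof. by rewrite lvarE psubstX. Qed.

Lemma dsubst_id n (q : {mpoly A[n]}) : dsubst (ddel K n) q = q.
Proof.
elim/mpolyind: q => [|c i q _ _ IH]; first exact: rmorph0.
rewrite rmorphD /= IH; congr (_ + _); rewrite -mul_mpolyC rmorphM /=.
congr (_ * _); last first.
  rewrite mpolyXE_id rmorph_prod /=; apply: eq_bigr => j _.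
  by rewrite rmorphXn /= dsubstX.
elim/poly_ind: c => [|c a IHc]; first by rewrite mpolyC0 rmorph0.
rewrite mpolyCD mpolyCM rmorphD rmorphM /= IHc.
by rewrite -/(ddel K n) dsubst_ddel -/(lcst n a) dsubst_lcst.
Qed.

(** Linearity of [lex] in the map rather than in the argument. As [lat2] is an iterated extension,
    this gives its linearity on the left. *)
Lemma lex_comb n (V W : lmodType A) q (f g h : V -> {lpoly W[n]}) x :
    klinear f -> klinear g -> klinear h -> (forall v, h v = q *: f v + g v) ->
  lex h x = q *: lex f x + lex g x.
Proof.
move=> fL gL hL hE; elim/lpoly_gen_ind: x => [v|i x IH|x y IHx IHy].
- by rewrite !lexC.
- by rewrite !lexX // IH scalerDr !scalerA mulrC.
- by rewrite !lexD // IHx IHy scalerDr addrACA.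
Qed.

Lemma klinear_lsub n (V W : lmodType A) p (f : V -> {lpoly W[1]}) :
  klinear f -> klinear (fun v => lsub (fun=> p : {mpoly A[n]}) (f v)).
Proof. by move=> fL c u v; rewrite fL lsubD lsubZ psubst_lcst. Qed.

Section At2.
Variables U V W : lmodType A.
Variable B : U -> V -> {lpoly W[1]}.
Hypothesis Bconf : conformal_bilinear B.

Section Fixed.
Variables (n : nat) (p : {mpoly A[n]}).
Implicit Types (x : {lpoly U[n]}) (y : {lpoly V[n]}) (q : {mpoly A[n]}).

Lemma lat2E x y :
  lat2 B p x y = lex (fun u => lex (fun v => lsub (fun=> p) (B u v)) y) x.
Proof. by rewrite lat2.unlock lex.unlock lsub.unlock. Qed.

Let klinear_r u : klinear (fun v => lsub (fun=> p) (B u v)).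
Proof. by apply: klinear_lsub; case: Bconf. Qed.

Let klinear_l y : klinear (fun u => lex (fun v => lsub (fun=> p) (B u v)) y).
Proof.
move=> c u u'; apply: lex_comb => // v.
by have [/(_ v) Bl _ _ _] := Bconf; rewrite Bl lsubD lsubZ psubst_lcst.
Qed.

Lemma lat2C u v : lat2 B p u%:l v%:l = lsub (fun=> p) (B u v).
Proof. by rewrite lat2E !lexC. Qed.

Lemma lat2Dl x x' y : lat2 B p (x + x') y = lat2 B p x y + lat2 B p x' y.
Proof. by rewrite !lat2E lexD. Qed.

Lemma lat2Dr x y y' : lat2 B p x (y + y') = lat2 B p x y + lat2 B p x y'.
Proof.
elim/lpoly_gen_ind: x => [u|i x IH|x x' IHx IHx'].
- by rewrite !lat2E !lexC // lexD.
- have E z : lat2 B p ('X_i *: x) z = 'X_i *: lat2 B p x z by rewrite !lat2E lexX.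
  by rewrite !E IH scalerDr.
- by rewrite !lat2Dl IHx IHx' addrACA.
Qed.

Lemma lat2Zl q x y : lat2 B p (q *: x) y = dsubst (- p) q *: lat2 B p x y.
Proof.
rewrite !lat2E; apply: lex_scale => // u.
(* [lex_comb] expects a combination q f + g; the zero map serves as g in the form [B 0], whose
   K-linearity is already available. *)
rewrite -[RHS]addr0 -(lex0 (klinear_r 0)).
have B0 v : lsub (fun=> p) (B 0 v) = 0.
  by have [/(_ v) Bl _ _ _] := Bconf; rewrite (klinear0 Bl) lsub0.
transitivity (- p *: lex (fun v => lsub (fun=> p) (B u v)) y
              + lex (fun v => lsub (fun=> p) (B 0 v)) y); last first.
  congr (_ + _); rewrite (lex0 (klinear_r 0)).
  elim/lpoly_gen_ind: y => [v|i y IH|y z IHy IHz].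
  - by rewrite lexC.
  - by rewrite lexX // IH scaler0.
  - by rewrite lexD // IHy IHz addr0.
apply: lex_comb => // v; rewrite B0 addr0; have [_ _ -> _] := Bconf.
by rewrite lsubZ rmorphN /= (psubst_lvar _ (ord0 : 'I_1)).
Qed.

Lemma lat2Zr q x y : lat2 B p x (q *: y) = dsubst (ddel K n + p) q *: lat2 B p x y.
Proof.
elim/lpoly_gen_ind: x => [u|i x IH|x x' IHx IHx'].
- rewrite !lat2E !lexC //; apply: lex_scale => // v; have [_ _ _ ->] := Bconf.
  by rewrite lsubZ rmorphD /= psubst_ddel (psubst_lvar _ (ord0 : 'I_1)).
- by rewrite lat2Zl IH lat2Zl !scalerA mulrC.
- by rewrite !lat2Dl IHx IHx' scalerDr.
Qed.

Lemma lat2Xl i x y : lat2 B p ('X_i *: x) y = 'X_i *: lat2 B p x y.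
Proof. by rewrite lat2Zl dsubstX. Qed.

Lemma lat2Xr i x y : lat2 B p x ('X_i *: y) = 'X_i *: lat2 B p x y.
Proof. by rewrite lat2Zr dsubstX. Qed.

Lemma lat20l y : lat2 B p 0 y = 0.
Proof. by apply: (@addrI _ (lat2 B p 0 y)); rewrite -lat2Dl !addr0. Qed.

Lemma lat20r x : lat2 B p x 0 = 0.
Proof. by apply: (@addrI _ (lat2 B p x 0)); rewrite -lat2Dr !addr0. Qed.

End Fixed.

Section Subst.
Variables (k m n : nat) (s : 'I_m -> {mpoly A[n]}) (p : {mpoly A[m]}).
Variables (p' : {mpoly A[n]}) (t : 'I_k -> {mpoly A[m]}) (t' : 'I_k -> {mpoly A[n]}).
Hypothesis sp : psubst s p = p'.

Lemma lsub_lat2C u v : lsub s (lat2 B p u%:l v%:l) = lat2 B p' u%:l v%:l.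
Proof. by rewrite !lat2C lsub_comp sp. Qed.

(* d acts on the left argument of B_p as -p and on the right one as d + p. *)
Lemma lsub_lat2l z v :
  (forall i, dsubst (- p') (t' i) = psubst s (dsubst (- p) (t i))) ->
  lsub s (lat2 B p (lsub t z) v%:l) = lat2 B p' (lsub t' z) v%:l.
Proof.
move=> tt'; elim/lpoly_gen_ind: z => [u|i x IH|x y IHx IHy].
- by rewrite !lsubC lsub_lat2C.
- by rewrite !lsubZ !psubstX !lat2Zl lsubZ IH tt'.
- by rewrite !lsubD !lat2Dl lsubD IHx IHy.
Qed.

Lemma lsub_lat2r u z :
  (forall i, dsubst (ddel K n + p') (t' i) = psubst s (dsubst (ddel K m + p) (t i))) ->
  lsub s (lat2 B p u%:l (lsub t z)) = lat2 B p' u%:l (lsub t' z).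
Proof.
move=> tt'; elim/lpoly_gen_ind: z => [v|i x IH|x y IHx IHy].
- by rewrite !lsubC lsub_lat2C.
- by rewrite !lsubZ !psubstX !lat2Zr lsubZ IH tt'.
- by rewrite !lsubD !lat2Dr lsubD IHx IHy.
Qed.

End Subst.

End At2.

Section Sum.
Variables (U V W : lmodType A) (B C : U -> V -> {lpoly W[1]}).
Hypotheses (Bconf : conformal_bilinear B) (Cconf : conformal_bilinear C).

Lemma conformal_bilinearD : conformal_bilinear (fun u v => B u v + C u v).
Proof.
have [B1 B2 B3 B4] := Bconf; have [C1 C2 C3 C4] := Cconf; split.
- by move=> b c u v; rewrite B1 C1 scalerDr addrACA.
- by move=> b c u v; rewrite B2 C2 scalerDr addrACA.
- by move=> a b; rewrite B3 C3 scalerDr.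
- by move=> a b; rewrite B4 C4 scalerDr.
Qed.

Lemma lat2_sum n (p : {mpoly A[n]}) x y :
  lat2 (fun u v => B u v + C u v) p x y = lat2 B p x y + lat2 C p x y.
Proof.
have BCconf := conformal_bilinearD.
elim/lpoly_gen_ind: x => [u|i x IH|x x' IH IH']; first 1 last.
- by rewrite !lat2Xl // IH scalerDr.
- by rewrite !lat2Dl // IH IH' addrACA.
elim/lpoly_gen_ind: y => [v|i y IH|y y' IH IH'].
- by rewrite !lat2C // lsubD.
- by rewrite !lat2Xr // IH scalerDr.
- by rewrite !lat2Dr // IH IH' addrACA.
Qed.

End Sum.

(** * Linear maps on coefficients, pullbacks and opposites *)

Section Map.
Variables (n : nat) (V W : lmodType A) (h : {linear V -> W}).

Let f v : {lpoly W[n]} := (h v)%:l.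

Let fL : klinear f.
Proof. by move=> c u v; rewrite /f linearD lconD linearZ /= lconZ. Qed.

Lemma lmpE x : lmp h x = lex f x.
Proof. by rewrite lmp.unlock lex.unlock /f lcon.unlock. Qed.

Lemma lmpC v : lmp h (v%:l : {lpoly V[n]}) = (h v)%:l.
Proof. by rewrite lmpE lexC. Qed.

Lemma lmpD (x y : {lpoly V[n]}) : lmp h (x + y) = lmp h x + lmp h y.
Proof. by rewrite !lmpE lexD. Qed.

Lemma lmpZ q (x : {lpoly V[n]}) : lmp h (q *: x) = q *: lmp h x.
Proof.
rewrite !lmpE (@lex_scale _ _ _ _ _ fL (ddel K n)) ?dsubst_id // => v.
by rewrite /f linearZ /= lconZ.
Qed.

Lemma lmp0 : lmp h (0 : {lpoly V[n]}) = 0.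
Proof. by rewrite -(scale0r 0) lmpZ scale0r. Qed.

Lemma lmpN (x : {lpoly V[n]}) : lmp h (- x) = - lmp h x.
Proof. by rewrite -scaleN1r lmpZ scaleN1r. Qed.

End Map.

Lemma lmp_comp n (U V W : lmodType A) (f : {linear U -> V}) (g : {linear V -> W})
    (h : {linear U -> W}) (x : {lpoly U[n]}) :
  (forall u, g (f u) = h u) -> lmp g (lmp f x) = lmp h x.
Proof.
move=> gf; elim/lpoly_gen_ind: x => [u|i x IH|x y IHx IHy].
- by rewrite !lmpC gf.
- by rewrite !lmpZ IH.
- by rewrite !lmpD IHx IHy.
Qed.

Lemma lmp_id n (V : lmodType A) (h : {linear V -> V}) (x : {lpoly V[n]}) :
  (forall v, h v = v) -> lmp h x = x.
Proof.
move=> hE; elim/lpoly_gen_ind: x => [u|i x IH|x y IHx IHy].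
- by rewrite !lmpC hE.
- by rewrite !lmpZ IH.
- by rewrite !lmpD IHx IHy.
Qed.

Lemma lmp_null n (V W : lmodType A) (h : {linear V -> W}) (x : {lpoly V[n]}) :
  (forall v, h v = 0) -> lmp h x = 0.
Proof.
move=> hE; elim/lpoly_gen_ind: x => [u|i x IH|x y IHx IHy].
- by rewrite !lmpC hE lcon0.
- by rewrite !lmpZ IH scaler0.
- by rewrite !lmpD IHx IHy addr0.
Qed.

Lemma lsub_lmp m n (V W : lmodType A) (h : {linear V -> W})
    (s : 'I_m -> {mpoly A[n]}) (x : {lpoly V[m]}) :
  lsub s (lmp h x) = lmp h (lsub s x).
Proof.
elim/lpoly_gen_ind: x => [u|i x IH|x y IHx IHy].
- by rewrite !lsubC !lmpC lsubC.
- by rewrite lmpZ !lsubZ IH lmpZ.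
- by rewrite lmpD !lsubD IHx IHy lmpD.
Qed.

Section Pullback.
Variables (U V W U' V' W' : lmodType A) (B : U -> V -> {lpoly W[1]}).
Variables (f : {linear U' -> U}) (g : {linear V' -> V}) (h : {linear W -> W'}).
Hypothesis Bconf : conformal_bilinear B.

(** With projections for [f], [g] and an injection for [h], this carries a map between summands to
    the direct sum; with injections for [f], [g] and a projection for [h], it extracts a component
    of a map on the direct sum. *)
Definition pullback u v := lmp h (B (f u) (g v)).

Lemma conformal_pullback : conformal_bilinear pullback.
Proof.
have [B1 B2 B3 B4] := Bconf; rewrite /pullback; split.
- by move=> b c u v; rewrite linearD linearZ /= B1 lmpD lmpZ.
- by move=> b c u v; rewrite linearD linearZ /= B2 lmpD lmpZ.
- by move=> a b; rewrite linearZ /= B3 lmpZ.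
- by move=> a b; rewrite linearZ /= B4 lmpZ.
Qed.

Lemma lat2_pullback n (p : {mpoly A[n]}) x y :
  lat2 pullback p x y = lmp h (lat2 B p (lmp f x) (lmp g y)).
Proof.
have pconf := conformal_pullback.
elim/lpoly_gen_ind: x => [u|i x IH|x x' IH IH']; first 1 last.
- by rewrite lmpZ !lat2Xl // IH lmpZ.
- by rewrite lmpD !lat2Dl // IH IH' lmpD.
elim/lpoly_gen_ind: y => [v|i y IH|y y' IH IH'].
- by rewrite !lmpC !lat2C // lsub_lmp.
- by rewrite lmpZ !lat2Xr // IH lmpZ.
- by rewrite lmpD !lat2Dr // IH IH' lmpD.
Qed.

End Pullback.

Section Opposite.
Variables U V W : lmodType A.
Implicit Type B : U -> V -> {lpoly W[1]}.

(* Turns r(b)_lambda u into the bilinear map (u, b) |-> r(b)_(-d-lambda) u. *)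
Definition bopp B v u := lsub (fun=> - ddel K 1 - lvar K 1 0) (B u v).

Lemma conformal_bopp B : conformal_bilinear B -> conformal_bilinear (bopp B).
Proof.
case=> B1 B2 B3 B4; rewrite /bopp; split.
- by move=> b c u v; rewrite B2 lsubD lsubZ psubst_lcst.
- by move=> b c u v; rewrite B1 lsubD lsubZ psubst_lcst.
- move=> a b; rewrite B4 lsubZ rmorphD /= psubst_ddel.
  by rewrite (psubst_lvar _ (ord0 : 'I_1)) addrA subrr sub0r.
- move=> a b; rewrite B3 lsubZ rmorphN /= (psubst_lvar _ (ord0 : 'I_1)).
  by rewrite opprB opprK addrC.
Qed.

Lemma lat2_bopp B n (p : {mpoly A[n]}) x y : conformal_bilinear B ->
  lat2 (bopp B) p y x = lat2 B (- ddel K n - p) x y.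
Proof.
move=> Bconf; have Oconf := conformal_bopp Bconf.
elim/lpoly_gen_ind: x => [u|i x IH|x x' IH IH']; first 1 last.
- by rewrite lat2Xr // lat2Xl // IH.
- by rewrite lat2Dr // lat2Dl // IH IH'.
elim/lpoly_gen_ind: y => [v|i y IH|y y' IH IH'].
- rewrite !lat2C // /bopp lsub_comp; apply: eq_lsub => _.
  by rewrite rmorphB rmorphN /= psubst_ddel (psubst_lvar _ (ord0 : 'I_1)).
- by rewrite lat2Xl // lat2Xr // IH.
- by rewrite lat2Dr // lat2Dl // IH IH'.
Qed.

End Opposite.

(** The substitution of -d-lambda for lambda is an involution, so r can be recovered from the
    component of c on H x R. *)
Lemma boppK (U V W : lmodType A) (B : U -> V -> {lpoly W[1]}) u v :
  bopp (bopp B) u v = B u v.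
Proof.
rewrite /bopp lsub_comp lsub_id // => i.
rewrite rmorphB rmorphN /= psubst_ddel (psubst_lvar _ (ord0 : 'I_1)) opprB.
by rewrite opprK addrC addrK (ord1 i) -lvarE.
Qed.

End Bilinear.

(** * The graded product in degree one *)

Section Graded.
Variables (K : fieldType) (E : lmodType {poly K}).
Local Notation lam := (lvar K 2 0).
Local Notation mu := (lvar K 2 1).

Definition pair_arg (x y : E) : {ffun 'I_2 -> E} :=
  [ffun i => if i == ord0 then x else y].

Definition binary (g : cochain E 1) (x y : E) := g (pair_arg x y).

Definition prod_bilinear (g t : E -> E -> {lpoly E[1]}) (x y z : E) : {lpoly E[2]} :=
  lat2 g (lam + mu) (lat2 t lam x%:l y%:l) z%:l
  - lat2 g lam x%:l (lat2 t mu y%:l z%:l)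
  + lat2 g mu y%:l (lat2 t lam x%:l z%:l).

Lemma pair_argE (a : {ffun 'I_2 -> E}) : pair_arg (a ord0) (a ord_max) = a.
Proof.
apply/ffunP => i; rewrite ffunE; case: eqP => [->//|/eqP i0].
by congr (a _); apply/val_inj; case: i i0 => [[|[|]]].
Qed.

Lemma big_S2 (V : zmodType) (F : 'S_2 -> V) :
  \sum_(s : 'S_2) F s = F 1%g + F (tperm ord0 ord_max).
Proof.
rewrite (bigD1 1%g) //=; congr (_ + _); apply: big_pred1 => s /=.
apply/idP/eqP => [s1|->]; last first.
  by apply/eqP => /permP /(_ ord0); rewrite tpermL perm1.
have s0 : s ord0 != ord0.
  apply: contraNneq s1 => s0; apply/eqP/permP => i; rewrite perm1.
  have [->//|i0] := eqVneq i ord0.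
  have: s i != s ord0 by rewrite (inj_eq perm_inj).
  rewrite s0; move: (s i) i0 => j; move: i => [[|[|]]] // ?;
  move: j => [[|[|]]] //= *; exact/val_inj.
apply/permP => i; have [->|i0] := eqVneq i ord0.
  by rewrite tpermL; move: (s ord0) s0 => [[|[|]]] // *; apply/val_inj.
have iE : i = ord_max by move: i i0 => [[|[|]]] // *; apply/val_inj.
rewrite iE tpermR; have: s ord_max != s ord0 by rewrite (inj_eq perm_inj).
by move: (s ord0) s0 (s ord_max) => [[|[|]]] // ? _ [[|[|]]] //= *; apply/val_inj.
Qed.

Lemma big_S1 (V : zmodType) (F : 'S_1 -> V) : \sum_(s : 'S_1) F s = F 1%g.
Proof.
apply: big_pred1 => s; apply/esym/eqP/permP => i.
by rewrite !ord1.
Qed.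

Lemma perm_natE p (s : 'S_p) (i : 'I_p) : perm_nat s i = s i.
Proof. by rewrite /perm_nat valK. Qed.

Section Term.
Variables g t : cochain E 1.
Hypotheses (gc : conformal_bilinear (binary g)) (tc : conformal_bilinear (binary t)).
Variables (n : nat) (p q : {mpoly {poly K}[n]}) (s s' : 'I_1 -> {mpoly {poly K}[n]}).
Variables (G : E -> {ffun 'I_2 -> E}) (b : {ffun 'I_2 -> E}) (x y z : E).
Hypotheses (sE : s ord0 = p) (s'E : s' ord0 = q) (bE : b = pair_arg x y).

(** The substitutions and argument tuples are arbitrary up to equations, so that the concrete ones
    of the graded product, indexed through [perm_nat] and [inord], need only be compared entry by
    entry. This form covers k = 0; [prod_term_r] covers k = 1. *)
Lemma prod_term_l : (forall w, G w = pair_arg w z) ->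
  lext (fun w => lsubst s (g (G w))) (lsubst s' (t b)) =
  lat2 (binary g) p (lat2 (binary t) q x%:l y%:l) z%:l.
Proof.
move=> GE; rewrite -lex.unlock -lsub.unlock lat2C // bE (lat2E (binary g)).
rewrite (@eq_lsub _ _ _ _ s' (fun=> q)) => [|i]; last by rewrite ord1.
apply: eq_lex => w; rewrite lexC; last by apply: klinear_lsub; case: gc.
by rewrite GE; apply: eq_lsub => i; rewrite ord1.
Qed.

Lemma prod_term_r : (forall w, G w = pair_arg z w) ->
  lext (fun w => lsubst s (g (G w))) (lsubst s' (t b)) =
  lat2 (binary g) p z%:l (lat2 (binary t) q x%:l y%:l).
Proof.
move=> GE; rewrite -lex.unlock -lsub.unlock lat2C // bE (lat2E (binary g)).
rewrite (@eq_lsub _ _ _ _ s' (fun=> q)) => [|i]; last by rewrite ord1.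
have [gl gr _ _] := gc; rewrite lexC; last first.
  move=> c u v; apply: lex_comb => [||| w]; try exact: klinear_lsub.
  by rewrite gl lsubD lsubZ psubst_lcst.
apply: eq_lex => w.
by rewrite GE; apply: eq_lsub => i; rewrite ord1.
Qed.

End Term.

(** The shape of the graded product once its sums are unfolded: [c0] and [c2] are the signs
    (-1)^(kn) for k = 0 and k = 1, the others are signs of permutations. Applying it separates the
    five signs from the three nested terms. *)
Lemma scaled_terms (P : pzRingType) (M : lmodType P) (c0 c1 c2 c3 c4 : P)
    (x0 x1 x2 y0 y1 y2 : M) :
    c0 = 1 -> c1 = 1 -> c2 = -1 -> c3 = 1 -> c4 = -1 ->
    x0 = y0 -> x1 = y1 -> x2 = y2 ->
  c0 *: (c1 *: x0) + c2 *: (c3 *: x1 + c4 *: x2) = y0 - y1 + y2.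
Proof.
move=> -> -> -> -> -> -> -> ->.
by rewrite !scale1r !scaleN1r opprD opprK addrA.
Qed.

Lemma graded_prod_binary (g t : cochain E 1) (a : {ffun 'I_3 -> E}) :
  conformal_bilinear (binary g) -> conformal_bilinear (binary t) ->
  graded_prod g t a = prod_bilinear (binary g) (binary t)
    (a ord0) (a (inord 1)) (a ord_max).
Proof.
move=> gc tc; rewrite /graded_prod big_ord_recl big_ord_recl big_ord0 addr0 /=.
(* The shuffle condition only compares indices of the same block. Here n = 1 and k is 0 or 1, so
   each block has at most one element and every permutation is a shuffle. *)
rewrite (eq_bigl predT); last first.
  by move=> s; apply/forallP => i; apply/forallP => j; rewrite !ord1.
rewrite (@big_S1 _ (fun s => _)).
rewrite [X in _ + _ *: X](eq_bigl predT); last first.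
  by move=> s; apply/forallP => -[[|[|//]] i]; apply/forallP => -[[|[|//]] j].
rewrite (@big_S2 _ (fun s => _)).
have i0 : inord 0 = ord0 :> 'I_3 by apply/val_inj; rewrite /= inordK.
have i2 : inord 2 = ord_max :> 'I_3 by apply/val_inj; rewrite /= inordK.
have p1 : @perm_nat 1 1 0 = 0%N by rewrite (perm_natE _ (ord0 : 'I_1)) perm1.
have t0 : perm_nat (tperm ord0 ord_max : 'S_2) 0 = 1%N.
  by rewrite (perm_natE _ (ord0 : 'I_2)) tpermL.
have t1 : perm_nat (tperm ord0 ord_max : 'S_2) 1 = 0%N.
  by rewrite (perm_natE _ (ord_max : 'I_2)) tpermR.
have q0 : @perm_nat 2 1 0 = 0%N by rewrite (perm_natE _ (ord0 : 'I_2)) perm1.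
have q1 : @perm_nat 2 1 1 = 1%N by rewrite (perm_natE _ (ord_max : 'I_2)) perm1.
have split2 (f f' : {ffun 'I_2 -> E}) :
    f ord0 = f' ord0 -> f ord_max = f' ord_max -> f = f'.
  by move=> f0 f1; rewrite -(pair_argE f) -(pair_argE f') f0 f1.
have aE k k' : k = k' -> a (inord k) = a (inord k') by move->.
apply: scaled_terms.
- by rewrite mul0n expr0.
- by rewrite odd_perm1 expr0.
- by rewrite -[RHS]expr1; congr (_ ^+ _).
- by rewrite odd_perm1 expr0.
- by rewrite odd_tperm expr1.
- apply: prod_term_l => // [|||w]; rewrite ?big_ord1.
  + by congr (_ + _); exact: (congr1 (lvar K 2) p1).
  + exact: (congr1 (lvar K 2) p1).
  + by apply: split2; rewrite !ffunE /= -?i0; exact: aE.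
  + by apply: split2; rewrite !ffunE //= -i2; exact: aE.
- apply: prod_term_r => // [|||w].
  + exact: (congr1 (lvar K 2) q0).
  + exact: (congr1 (lvar K 2) q1).
  + by apply: split2; rewrite !ffunE /= -?i2; exact: aE.
  + by apply: split2; rewrite !ffunE //= -i0; exact: aE.
- apply: prod_term_r => // [|||w].
  + exact: (congr1 (lvar K 2) t0).
  + exact: (congr1 (lvar K 2) t1).
  + by apply: split2; rewrite !ffunE /= -?i0 -?i2; exact: aE.
  + by apply: split2; rewrite !ffunE //=; exact: aE.
Qed.
End Graded.

(** * The Maurer-Cartan equation on a direct sum *)

Section Defects.
Variable K : fieldType.
Local Notation lam := (lvar K 2 0).
Local Notation mu := (lvar K 2 1).
Variables R H : lmodType {poly K}.
Variables (bR : R -> R -> {lpoly R[1]}) (bH : H -> H -> {lpoly H[1]}).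
Variables (l : R -> H -> {lpoly H[1]}) (r : H -> R -> {lpoly H[1]}).
Variable chi : R -> R -> {lpoly H[1]}.

(* The value of the Maurer-Cartan expression at arguments taken successively from
   the summands named in the suffix; r stands for (u, b) |-> r(b)_(-d-lambda) u. *)
Definition defectRRR a b c : {lpoly H[2]} :=
  lat2 chi (lam + mu) (lat2 bR lam a%:l b%:l) c%:l
  - lat2 chi lam a%:l (lat2 bR mu b%:l c%:l)
  + lat2 chi mu b%:l (lat2 bR lam a%:l c%:l)
  + lat2 r (lam + mu) (lat2 chi lam a%:l b%:l) c%:l
  - lat2 l lam a%:l (lat2 chi mu b%:l c%:l)
  + lat2 l mu b%:l (lat2 chi lam a%:l c%:l).

Definition defectRRH a b h : {lpoly H[2]} :=
  lat2 bH (lam + mu) (lat2 chi lam a%:l b%:l) h%:l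
  + lat2 l (lam + mu) (lat2 bR lam a%:l b%:l) h%:l
  - lat2 l lam a%:l (lat2 l mu b%:l h%:l)
  + lat2 l mu b%:l (lat2 l lam a%:l h%:l).

Definition defectRHR a h b : {lpoly H[2]} :=
  lat2 bH mu h%:l (lat2 chi lam a%:l b%:l)
  + lat2 r mu h%:l (lat2 bR lam a%:l b%:l)
  + lat2 r (lam + mu) (lat2 l lam a%:l h%:l) b%:l
  - lat2 l lam a%:l (lat2 r mu h%:l b%:l).

Definition defectHRR h a b : {lpoly H[2]} :=
  - lat2 bH lam h%:l (lat2 chi mu a%:l b%:l)
  - lat2 r lam h%:l (lat2 bR mu a%:l b%:l)
  + lat2 r (lam + mu) (lat2 r lam h%:l a%:l) b%:l
  + lat2 l mu a%:l (lat2 r lam h%:l b%:l).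

Definition defectRHH a u v : {lpoly H[2]} :=
  lat2 bH (lam + mu) (lat2 l lam a%:l u%:l) v%:l
  + lat2 bH mu u%:l (lat2 l lam a%:l v%:l)
  - lat2 l lam a%:l (lat2 bH mu u%:l v%:l).

Definition defectHRH u a v : {lpoly H[2]} :=
  lat2 bH (lam + mu) (lat2 r lam u%:l a%:l) v%:l
  - lat2 bH lam u%:l (lat2 l mu a%:l v%:l)
  + lat2 l mu a%:l (lat2 bH lam u%:l v%:l).

Definition defectHHR u v a : {lpoly H[2]} :=
  - lat2 bH lam u%:l (lat2 r mu v%:l a%:l)
  + lat2 bH mu v%:l (lat2 r lam u%:l a%:l)
  + lat2 r (lam + mu) (lat2 bH lam u%:l v%:l) a%:l.

Record defects_vanish : Prop := DefectsVanish {
  vanishRRR : forall a b c, defectRRR a b c = 0;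
  vanishRRH : forall a b h, defectRRH a b h = 0;
  vanishRHR : forall a h b, defectRHR a h b = 0;
  vanishHRR : forall h a b, defectHRR h a b = 0;
  vanishRHH : forall a u v, defectRHH a u v = 0;
  vanishHRH : forall u a v, defectHRH u a v = 0;
  vanishHHR : forall u v a, defectHHR u v a = 0 }.

End Defects.

Section Biproduct.
Variable K : fieldType.
Local Notation A := {poly K}.
Local Notation lam := (lvar K 2 0).
Local Notation mu := (lvar K 2 1).
Variables (R H E : lmodType A) (i1 : {linear R -> E}) (i2 : {linear H -> E}).
Variables (p1 : {linear E -> R}) (p2 : {linear E -> H}).
Hypotheses (p1i1 : forall a, p1 (i1 a) = a) (p1i2 : forall h, p1 (i2 h) = 0).
Hypotheses (p2i1 : forall a, p2 (i1 a) = 0) (p2i2 : forall h, p2 (i2 h) = h).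

Section Lpoly.
Variable n : nat.

Lemma lmp_p1i1 (x : {lpoly R[n]}) : lmp p1 (lmp i1 x) = x.
Proof. by rewrite (@lmp_comp _ _ _ _ _ _ _ idfun) // lmp_id. Qed.

Lemma lmp_p2i1 (x : {lpoly R[n]}) : lmp p2 (lmp i1 x) = 0.
Proof. by rewrite (@lmp_comp _ _ _ _ _ _ _ (p2 \o i1)) // lmp_null. Qed.

Lemma lmp_p1i2 (x : {lpoly H[n]}) : lmp p1 (lmp i2 x) = 0.
Proof. by rewrite (@lmp_comp _ _ _ _ _ _ _ (p1 \o i2)) // lmp_null. Qed.

Lemma lmp_p2i2 (x : {lpoly H[n]}) : lmp p2 (lmp i2 x) = x.
Proof. by rewrite (@lmp_comp _ _ _ _ _ _ _ idfun) // lmp_id. Qed.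

Lemma lmp_i2_eq0 (x : {lpoly H[n]}) : lmp i2 x = 0 <-> x = 0.
Proof.
split=> [x0|->]; last exact: lmp0.
by rewrite -(lmp_p2i2 x) x0 lmp0.
Qed.

End Lpoly.

Variables (bR : R -> R -> {lpoly R[1]}) (bH : H -> H -> {lpoly H[1]}).
Variables (l : R -> H -> {lpoly H[1]}) (r : H -> R -> {lpoly H[1]}).
Variable chi : R -> R -> {lpoly H[1]}.
Hypotheses (bRC : conformal_bilinear bR) (bHC : conformal_bilinear bH).
Hypotheses (lC : conformal_bilinear l) (rC : conformal_bilinear r).
Hypothesis chiC : conformal_bilinear chi.

Definition sum_bracket (x y : E) : {lpoly E[1]} :=
  pullback bR p1 p1 i1 x y + pullback bH p2 p2 i2 x y.

(** There is no H x H term because L^1 is the sum of C^(1,1) and C^(2,0); [l] and [r] are the two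
    halves of the C^(1,1) part. *)
Definition mixed_bracket (x y : E) : {lpoly E[1]} :=
  pullback l p1 p2 i2 x y + pullback r p2 p1 i2 x y + pullback chi p1 p1 i2 x y.

Lemma conformal_sum_bracket : conformal_bilinear sum_bracket.
Proof. by apply: conformal_bilinearD; apply: conformal_pullback. Qed.

Lemma conformal_mixed_bracket : conformal_bilinear mixed_bracket.
Proof. by do 2?apply: conformal_bilinearD; apply: conformal_pullback. Qed.

Section Values.
Variables (n : nat) (p : {mpoly A[n]}).
Implicit Types (x y : {lpoly R[n]}) (u v : {lpoly H[n]}).

Lemma lat2_sum_bracket (x y : {lpoly E[n]}) :
  lat2 sum_bracket p x y =
  lmp i1 (lat2 bR p (lmp p1 x) (lmp p1 y)) + lmp i2 (lat2 bH p (lmp p2 x) (lmp p2 y)).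
Proof. by rewrite lat2_sum ?lat2_pullback //; apply: conformal_pullback. Qed.

Lemma lat2_mixed_bracket (x y : {lpoly E[n]}) :
  lat2 mixed_bracket p x y =
  lmp i2 (lat2 l p (lmp p1 x) (lmp p2 y)) + lmp i2 (lat2 r p (lmp p2 x) (lmp p1 y))
  + lmp i2 (lat2 chi p (lmp p1 x) (lmp p1 y)).
Proof.
rewrite lat2_sum; first last.
- exact: conformal_pullback.
- by apply: conformal_bilinearD; apply: conformal_pullback.
by rewrite lat2_sum ?lat2_pullback //; apply: conformal_pullback.
Qed.

Lemma sum_bracketRR x y :
  lat2 sum_bracket p (lmp i1 x) (lmp i1 y) = lmp i1 (lat2 bR p x y).
Proof. by rewrite lat2_sum_bracket !lmp_p1i1 !lmp_p2i1 (lat20l bHC) lmp0 addr0. Qed.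

Lemma sum_bracketRH x v : lat2 sum_bracket p (lmp i1 x) (lmp i2 v) = 0.
Proof.
by rewrite lat2_sum_bracket lmp_p1i2 lmp_p2i1 (lat20l bHC) (lat20r bRC) !lmp0 addr0.
Qed.

Lemma sum_bracketHR u y : lat2 sum_bracket p (lmp i2 u) (lmp i1 y) = 0.
Proof.
by rewrite lat2_sum_bracket lmp_p1i2 lmp_p2i1 (lat20r bHC) (lat20l bRC) !lmp0 addr0.
Qed.

Lemma sum_bracketHH u v :
  lat2 sum_bracket p (lmp i2 u) (lmp i2 v) = lmp i2 (lat2 bH p u v).
Proof. by rewrite lat2_sum_bracket !lmp_p1i2 !lmp_p2i2 (lat20l bRC) lmp0 add0r. Qed.

Lemma mixed_bracketRR x y :
  lat2 mixed_bracket p (lmp i1 x) (lmp i1 y) = lmp i2 (lat2 chi p x y).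
Proof.
rewrite lat2_mixed_bracket !lmp_p1i1 !lmp_p2i1 (lat20l rC) (lat20r lC) !lmp0.
by rewrite !add0r.
Qed.

Lemma mixed_bracketRH x v :
  lat2 mixed_bracket p (lmp i1 x) (lmp i2 v) = lmp i2 (lat2 l p x v).
Proof.
rewrite lat2_mixed_bracket !lmp_p1i1 !lmp_p2i1 !lmp_p1i2 !lmp_p2i2 (lat20l rC).
by rewrite (lat20r chiC) !lmp0 !addr0.
Qed.

Lemma mixed_bracketHR u y :
  lat2 mixed_bracket p (lmp i2 u) (lmp i1 y) = lmp i2 (lat2 r p u y).
Proof.
rewrite lat2_mixed_bracket !lmp_p1i1 !lmp_p2i1 !lmp_p1i2 !lmp_p2i2 (lat20l lC).
by rewrite (lat20l chiC) !lmp0 addr0 add0r.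
Qed.

Lemma mixed_bracketHH u v : lat2 mixed_bracket p (lmp i2 u) (lmp i2 v) = 0.
Proof.
rewrite lat2_mixed_bracket !lmp_p1i2 !lmp_p2i2 (lat20l lC).
by rewrite (lat20l chiC) (lat20r rC) !lmp0 !addr0.
Qed.

End Values.

Definition mc_defect (x y z : E) : {lpoly E[2]} :=
  prod_bilinear sum_bracket mixed_bracket x y z +
  prod_bilinear mixed_bracket sum_bracket x y z +
  prod_bilinear mixed_bracket mixed_bracket x y z.

Let sC := conformal_sum_bracket.
Let mC := conformal_mixed_bracket.

Local Ltac expand_defect :=
  rewrite /mc_defect /prod_bilinear -!lmpC
    /defectRRR /defectRRH /defectRHR /defectHRR /defectRHH /defectHRH /defectHHR;
  (* A second pass is needed for an outer [sum_bracket] around an inner [mixed_bracket]: its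
     argument becomes the image of an injection only at the end of the first pass. *)
  do 2!rewrite ?(sum_bracketRR, sum_bracketRH, sum_bracketHR, sum_bracketHH)
    ?(mixed_bracketRR, mixed_bracketRH, mixed_bracketHR, mixed_bracketHH);
  rewrite ?(lat20l sC, lat20r sC, lat20l mC, lat20r mC);
  rewrite ?(oppr0, addr0, add0r) ?(lmpD, lmpN) ?addrA.

Lemma mc_defectRRR a b c :
  mc_defect (i1 a) (i1 b) (i1 c) = lmp i2 (defectRRR bR l r chi a b c).
Proof. by expand_defect. Qed.

Lemma mc_defectRRH a b h :
  mc_defect (i1 a) (i1 b) (i2 h) = lmp i2 (defectRRH bR bH l chi a b h).
Proof. by expand_defect. Qed.

Lemma mc_defectRHR a h b :
  mc_defect (i1 a) (i2 h) (i1 b) = lmp i2 (defectRHR bR bH l r chi a h b).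
Proof. by expand_defect. Qed.

Lemma mc_defectHRR h a b :
  mc_defect (i2 h) (i1 a) (i1 b) = lmp i2 (defectHRR bR bH l r chi h a b).
Proof. by expand_defect. Qed.

Lemma mc_defectRHH a u v :
  mc_defect (i1 a) (i2 u) (i2 v) = lmp i2 (defectRHH bH l a u v).
Proof. by expand_defect. Qed.

Lemma mc_defectHRH u a v :
  mc_defect (i2 u) (i1 a) (i2 v) = lmp i2 (defectHRH bH l r u a v).
Proof. by expand_defect. Qed.

Lemma mc_defectHHR u v a :
  mc_defect (i2 u) (i2 v) (i1 a) = lmp i2 (defectHHR bH r u v a).
Proof. by expand_defect. Qed.

Lemma mc_defectHHH u v w : mc_defect (i2 u) (i2 v) (i2 w) = 0.
Proof. by expand_defect. Qed.

Section Additivity.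
Variables (g t : E -> E -> {lpoly E[1]}).
Hypotheses (gC : conformal_bilinear g) (tC : conformal_bilinear t).

Lemma prod_bilinearD1 x x' y z :
  prod_bilinear g t (x + x') y z = prod_bilinear g t x y z + prod_bilinear g t x' y z.
Proof.
rewrite /prod_bilinear lconD !(lat2Dl tC, lat2Dl gC, lat2Dr gC) opprD.
by rewrite [X in X + _ = _]addrACA [RHS]addrACA.
Qed.

Lemma prod_bilinearD2 x y y' z :
  prod_bilinear g t x (y + y') z = prod_bilinear g t x y z + prod_bilinear g t x y' z.
Proof.
rewrite /prod_bilinear lconD !(lat2Dl tC, lat2Dr tC, lat2Dl gC, lat2Dr gC) opprD.
by rewrite [X in X + _ = _]addrACA [RHS]addrACA.
Qed.

Lemma prod_bilinearD3 x y z z' :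
  prod_bilinear g t x y (z + z') = prod_bilinear g t x y z + prod_bilinear g t x y z'.
Proof.
rewrite /prod_bilinear lconD !(lat2Dr tC, lat2Dr gC) opprD.
by rewrite [X in X + _ = _]addrACA [RHS]addrACA.
Qed.

End Additivity.

Lemma mc_defectD1 x x' y z :
  mc_defect (x + x') y z = mc_defect x y z + mc_defect x' y z.
Proof.
by rewrite /mc_defect !prod_bilinearD1 // [X in X + _ = _]addrACA [RHS]addrACA. Qed.

Lemma mc_defectD2 x y y' z :
  mc_defect x (y + y') z = mc_defect x y z + mc_defect x y' z.
Proof.
by rewrite /mc_defect !prod_bilinearD2 // [X in X + _ = _]addrACA [RHS]addrACA. Qed.

Lemma mc_defectD3 x y z z' :
  mc_defect x y (z + z') = mc_defect x y z + mc_defect x y z'.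
Proof.
by rewrite /mc_defect !prod_bilinearD3 // [X in X + _ = _]addrACA [RHS]addrACA. Qed.

Lemma mc_defect_eq0 : (forall x, x = i1 (p1 x) + i2 (p2 x)) ->
  (forall x y z, mc_defect x y z = 0) <-> defects_vanish bR bH l r chi.
Proof.
move=> xE; split=> [D0|[e1 e2 e3 e4 e5 e6 e7] x y z].
  split=> x y z; apply/lmp_i2_eq0.
  - by rewrite -mc_defectRRR D0.
  - by rewrite -mc_defectRRH D0.
  - by rewrite -mc_defectRHR D0.
  - by rewrite -mc_defectHRR D0.
  - by rewrite -mc_defectRHH D0.
  - by rewrite -mc_defectHRH D0.
  - by rewrite -mc_defectHHR D0.
rewrite (xE x) (xE y) (xE z) !(mc_defectD1, mc_defectD2, mc_defectD3).
rewrite mc_defectRRR mc_defectRRH mc_defectRHR mc_defectHRR mc_defectRHH.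
rewrite mc_defectHRH mc_defectHHR mc_defectHHH.
by rewrite e1 e2 e3 e4 e5 e6 e7 !lmp0 !addr0.
Qed.

End Biproduct.

(** * The defects and the cocycle conditions *)

Section Equations.
Variable K : fieldType.
Local Notation lam := (lvar K 2 0).
Local Notation mu := (lvar K 2 1).
Local Notation del := (ddel K 2).
Local Notation P2 := {mpoly {poly K}[2]}.

Definition subst2 (p q : P2) (i : 'I_2) : P2 := if i == ord0 then p else q.

Lemma psubst2_lam p q : psubst (subst2 p q) lam = p.
Proof. by rewrite (psubst_lvar _ (ord0 : 'I_2)). Qed.

Lemma psubst2_mu p q : psubst (subst2 p q) mu = q.
Proof. by rewrite (psubst_lvar _ (ord_max : 'I_2)). Qed.

Lemma psubstD m n (s : 'I_m -> {mpoly {poly K}[n]}) x y :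
  psubst s (x + y) = psubst s x + psubst s y.
Proof. exact: rmorphD. Qed.

Lemma psubstN m n (s : 'I_m -> {mpoly {poly K}[n]}) x : psubst s (- x) = - psubst s x.
Proof. exact: rmorphN. Qed.

Lemma dsubstD n (q x y : {mpoly {poly K}[n]}) :
  dsubst q (x + y) = dsubst q x + dsubst q y.
Proof. exact: rmorphD. Qed.

Lemma dsubstN n (q x : {mpoly {poly K}[n]}) : dsubst q (- x) = - dsubst q x.
Proof. exact: rmorphN. Qed.

Definition subst2E := (psubst2_lam, psubst2_mu, psubstD, psubstN, psubst_ddel,
  dsubstD, dsubstN, dsubst_ddel, dsubst_lvar).

(* ring is slow on {mpoly {poly K}[2]}, so the identity is first generalized to
   an arbitrary commutative ring. *)
Local Ltac translate C d x y t :=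
  lazymatch t with
  | ?a + ?b => let a' := translate C d x y a in
               let b' := translate C d x y b in constr:(@GRing.add C a' b')
  | - ?a => let a' := translate C d x y a in constr:(@GRing.opp C a')
  | ddel _ _ => d
  | lvar _ _ 0 => x
  | lvar _ _ 1 => y
  end.

Local Ltac subst2_ring :=
  rewrite ?subst2E;
  lazymatch goal with
  | |- ?u = ?v =>
    let H := fresh in
    assert (H : forall (C : comPzRingType) (d x y : C),
      ltac:(let u' := translate C d x y u in let v' := translate C d x y v in
            exact (u' = v')));
    [by move=> C d x y; ring | exact: (H _ del lam mu)]
  end.

(** The pair [p], [q] gives the inverse substitution. On the parameters lam, mu, -del - lam - mu the
    substitutions used below are two transpositions, each its own inverse, and one 3-cycle. *)
Lemma lsub_eq0 (V : lmodType {poly K}) (p q p' q' : P2) (x : {lpoly V[2]}) :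
    psubst (subst2 p q) p' = lam -> psubst (subst2 p q) q' = mu ->
  lsub (subst2 p' q') x = 0 <-> x = 0.
Proof.
move=> pE qE; split=> [x0|->]; last exact: lsub0.
rewrite -[x](@lsub_id _ _ _ (fun i => psubst (subst2 p q) (subst2 p' q' i))).
  by rewrite -lsub_comp x0 lsub0.
move=> i; rewrite -lvarE /subst2; case: eqP => [->//|/eqP i0].
by rewrite -/(subst2 p q) qE; move: i i0 => [[|[|]]].
Qed.

Section Terms.
Variables U U' V V' W : lmodType {poly K}.
Variables (B : U -> V -> {lpoly W[1]}).
Hypothesis BC : conformal_bilinear B.
Variables (s : 'I_2 -> P2) (p q p' q' : P2).

(** The inner subscripts [q] and [q'] are compared only after d has been replaced by its action on
    an argument of the outer map. *)
Lemma lsub_lat2_nestl (C : U' -> V' -> {lpoly U[1]}) a b v : conformal_bilinear C ->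
  psubst s p = p' -> dsubst (- p') q' = psubst s (dsubst (- p) q) ->
  lsub s (lat2 B p (lat2 C q a%:l b%:l) v%:l) = lat2 B p' (lat2 C q' a%:l b%:l) v%:l.
Proof. by move=> CC pE qE; rewrite !(lat2C CC); apply: lsub_lat2l. Qed.

Lemma lsub_lat2_nestr (C : U' -> V' -> {lpoly V[1]}) u a b : conformal_bilinear C ->
  psubst s p = p' -> dsubst (del + p') q' = psubst s (dsubst (del + p) q) ->
  lsub s (lat2 B p u%:l (lat2 C q a%:l b%:l)) = lat2 B p' u%:l (lat2 C q' a%:l b%:l).
Proof. by move=> CC pE qE; rewrite !(lat2C CC); apply: lsub_lat2r. Qed.

End Terms.

Variables R H : lmodType {poly K}.
Variables (bR : R -> R -> {lpoly R[1]}) (bH : H -> H -> {lpoly H[1]}).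
Variables l r : R -> H -> {lpoly H[1]}.
Variable chi : R -> R -> {lpoly H[1]}.
Hypotheses (bRC : conformal_bilinear bR) (bHC : conformal_bilinear bH).
Hypotheses (lC : conformal_bilinear l) (rC : conformal_bilinear r).
Hypothesis chiC : conformal_bilinear chi.

Let roC := conformal_bopp rC.

(* The invertible substitutions of (lambda, mu): S for RHR, Q for HHR and
   HRR, and swap to compare HRR with RHR and HRH with RHH. *)
Local Notation S := (subst2 lam (- del - lam - mu)).
Local Notation swap := (subst2 mu lam).
Local Notation Q := (subst2 mu (- del - lam - mu)).

Lemma addr4_eq0 (V : zmodType) (x y z t : V) : t + z + y - x = 0 <-> x - y - z = t.
Proof.
split=> [/eqP|<-]; last by rewrite !subrK subrr.
by rewrite subr_eq0 => /eqP <-; rewrite !addrK.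
Qed.

Lemma addr_cancel_pair (V : zmodType) (x y z t : V) :
  x - y + z + (t + y - z) = x + t.
Proof. by rewrite [LHS](AC (3*3) (1*4*(2*5)*(3*6))) /= addNr subrr !addr0. Qed.

Lemma addr_cancel_triple (V : zmodType) (x y z t w : V) :
  - x - y + z + t + (x + y + w - t) = z + w.
Proof.
by rewrite [LHS](AC (4*4) (3*7*(5*1)*(6*2)*(4*8))) /= !subrr !addr0.
Qed.

Lemma addNr_eq0 (V : zmodType) (x y z : V) : - x + y + z = 0 <-> z = x - y.
Proof.
have -> : - x + y + z = z - (x - y) by rewrite opprB addrC [y - x]addrC.
by split=> [/eqP|->]; rewrite ?subrr // subr_eq0 => /eqP.
Qed.

Lemma defectRRR_eq0 a b c : defectRRR bR l (bopp r) chi a b c = 0 <->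
  lat2 chi lam a%:l (lat2 bR mu b%:l c%:l) -
  lat2 chi mu b%:l (lat2 bR lam a%:l c%:l) -
  lat2 chi (lam + mu) (lat2 bR lam a%:l b%:l) c%:l +
  lat2 l lam a%:l (lat2 chi mu b%:l c%:l) -
  lat2 l mu b%:l (lat2 chi lam a%:l c%:l) -
  lat2 r (- del - lam - mu) c%:l (lat2 chi lam a%:l b%:l) = 0.
Proof.
rewrite /defectRRR (lat2_bopp _ _ _ rC) [in - del - (lam + mu)]opprD addrA.
set x1 := lat2 chi _ _ _; set x2 := lat2 chi _ _ _; set x3 := lat2 chi _ _ _.
set x4 := lat2 r _ _ _; set x5 := lat2 l _ _ _; set x6 := lat2 l _ _ _.
have E : x2 - x3 - x1 + x5 - x6 - x4 = - (x1 - x2 + x3 + x4 - x5 + x6).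
  by rewrite !opprD !opprK [RHS](ACl (2*3*1*5*6*4)).
rewrite E; split=> [->|/eqP]; first by rewrite oppr0.
by rewrite oppr_eq0 => /eqP.
Qed.

Lemma defectRRH_eq0 a b h : defectRRH bR bH l chi a b h = 0 <->
  lat2 l lam a%:l (lat2 l mu b%:l h%:l) -
  lat2 l mu b%:l (lat2 l lam a%:l h%:l) -
  lat2 l (lam + mu) (lat2 bR lam a%:l b%:l) h%:l =
  lat2 bH (lam + mu) (lat2 chi lam a%:l b%:l) h%:l.
Proof. by rewrite -addr4_eq0 /defectRRH [X in X = 0 <-> _](ACl (1*2*4*3)). Qed.

(** In the defect it is h that carries mu, whereas in (iii) it is b. The substitution exchanging mu
    with the third parameter -del - lam - mu passes from one to the other. *)
Lemma defectRHR_eq0 a h b : defectRHR bR bH l (bopp r) chi a h b = 0 <->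
  lat2 l lam a%:l (lat2 r mu b%:l h%:l) -
  lat2 r mu b%:l (lat2 l lam a%:l h%:l) -
  lat2 r (lam + mu) (lat2 bR lam a%:l b%:l) h%:l =
  lat2 bH (- del - lam - mu) h%:l (lat2 chi lam a%:l b%:l).
Proof.
apply: iff_trans (iff_sym (@lsub_eq0 _ lam (- del - lam - mu) lam (- del - lam - mu) _ _ _)) _;
  [subst2_ring..|].
rewrite /defectRHR !(lat2_bopp _ _ _ rC) lsubB !lsubD.
rewrite (@lsub_lat2_nestr _ _ _ _ _ bH bHC S mu lam (- del - lam - mu) lam
    chi _ _ _ chiC);
  [|subst2_ring..].
rewrite (@lsub_lat2_nestl _ _ _ _ _ r rC S (- del - mu) lam (lam + mu) lam
    bR _ _ _ bRC);
  [|subst2_ring..].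
rewrite (@lsub_lat2_nestr _ _ _ _ _ r rC S _ lam mu lam l _ _ _ lC); [|subst2_ring..].
(* Inside l(a)_lam the inner -del - mu acts as -del - lam - mu, which S sends to mu. *)
rewrite (@lsub_lat2_nestr _ _ _ _ _ l lC S lam (- del - mu) lam mu r _ _ _ rC);
  [|subst2_ring..].
exact: addr4_eq0.
Qed.

Lemma defectRHH_eq0 a u v : defectRHH bH l a u v = 0 <->
  lat2 l lam a%:l (lat2 bH mu u%:l v%:l) =
  lat2 bH mu u%:l (lat2 l lam a%:l v%:l) +
  lat2 bH (lam + mu) (lat2 l lam a%:l u%:l) v%:l.
Proof.
rewrite /defectRHH [X in _ <-> _ = X]addrC; split=> [/eqP|->]; last exact: subrr.
by rewrite subr_eq0 => /eqP.
Qed.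

(** The defect attaches lam, mu, -del - lam - mu to u, v, a in this order, while the derivation rule
    attaches lam to a and mu to u; the 3-cycle Q makes the change. *)
Lemma defectHHR_eq0 u v a : defectHHR bH (bopp r) u v a = 0 <->
  lat2 r lam a%:l (lat2 bH mu u%:l v%:l) =
  lat2 bH mu u%:l (lat2 r lam a%:l v%:l) -
  lat2 bH (- del - lam - mu) v%:l (lat2 r lam a%:l u%:l).
Proof.
rewrite -(@lsub_eq0 _ (- del - lam - mu) lam mu (- del - lam - mu)); [|subst2_ring..].
rewrite /defectHHR !(lat2_bopp _ _ _ rC) !lsubD lsubN.
rewrite (@lsub_lat2_nestr _ _ _ _ _ bH bHC Q lam (- del - mu) mu lam r _ _ _ rC);
  [|subst2_ring..].
rewrite (@lsub_lat2_nestr _ _ _ _ _ bH bHC Q mu (- del - lam) (- del - lam - mu) lam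
    r _ _ _ rC);
  [|subst2_ring..].
rewrite (@lsub_lat2_nestr _ _ _ _ _ r rC Q _ lam lam mu bH _ _ _ bHC); [|subst2_ring..].
exact: addNr_eq0.
Qed.

(** After lam and mu are exchanged, the two l-terms of HRH are opposite to terms of RHH. The sum of
    the two defects keeps only the brackets of r(a)u and l(a)u with v. *)
Lemma defectHRH_eq0 u a v : defectRHH bH l a u v = 0 ->
  defectHRH bH l (bopp r) u a v = 0 <->
  lat2 bH (lam + mu) (lat2 l lam a%:l u%:l + lat2 r lam a%:l u%:l) v%:l = 0.
Proof.
move=> RHH; rewrite -(@lsub_eq0 _ mu lam mu lam); [|subst2_ring..].
rewrite -[X in X = 0 <-> _](addr0 _) -[in X in X = 0 <-> _]RHH /defectHRH /defectRHH.
rewrite !(lat2_bopp _ _ _ rC) !lsubD lsubN.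
rewrite (@lsub_lat2_nestl _ _ _ _ _ bH bHC swap (lam + mu) (- del - lam) (lam + mu) lam
    r _ _ _ rC);
  [|subst2_ring..].
rewrite (@lsub_lat2_nestr _ _ _ _ _ bH bHC swap lam mu mu lam l _ _ _ lC);
  [|subst2_ring..].
rewrite (@lsub_lat2_nestr _ _ _ _ _ l lC swap mu lam lam mu bH _ _ _ bHC);
  [|subst2_ring..].
by rewrite addr_cancel_pair (lat2Dl bHC) addrC.
Qed.

(** After lam and mu are exchanged, the terms of HRR and RHR containing chi, the bracket of R, or
    l(a) applied to r(b)h cancel in pairs, leaving r(b) applied to r(a)h + l(a)h. *)
Lemma defectHRR_eq0 h a b : defectRHR bR bH l (bopp r) chi a h b = 0 ->
  defectHRR bR bH l (bopp r) chi h a b = 0 <->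
  lat2 r lam b%:l (lat2 r mu a%:l h%:l + lat2 l mu a%:l h%:l) = 0.
Proof.
move=> RHR; rewrite -(@lsub_eq0 _ mu lam mu lam); [|subst2_ring..].
have E : lsub swap (defectHRR bR bH l (bopp r) chi h a b) =
    lsub swap (defectHRR bR bH l (bopp r) chi h a b)
    + defectRHR bR bH l (bopp r) chi a h b.
  by rewrite RHR addr0.
rewrite {}E /defectHRR /defectRHR.
rewrite !(lat2_bopp _ _ _ rC) !lsubD !lsubN.
rewrite (@lsub_lat2_nestr _ _ _ _ _ bH bHC swap lam mu mu lam chi _ _ _ chiC);
  [|subst2_ring..].
rewrite (@lsub_lat2_nestl _ _ _ _ _ r rC swap (- del - lam) mu (- del - mu) lam
    bR _ _ _ bRC);
  [|subst2_ring..].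
rewrite (@lsub_lat2_nestr _ _ _ _ _ r rC swap (- del - (lam + mu)) (- del - lam) (- del - (lam + mu)) (- del - mu)
    r _ _ _ rC);
  [|subst2_ring..].
rewrite (@lsub_lat2_nestr _ _ _ _ _ l lC swap mu (- del - lam) lam (- del - mu)
    r _ _ _ rC);
  [|subst2_ring..].
rewrite addr_cancel_triple.
(* The outer r(b) still has subscript -del - lam - mu; Q turns it into lam. The inner -del - mu acts
   there as lam, which Q turns into mu. *)
rewrite -(@lsub_eq0 _ (- del - lam - mu) lam mu (- del - lam - mu)); [|subst2_ring..].
rewrite lsubD.
rewrite (@lsub_lat2_nestr _ _ _ _ _ r rC Q (- del - (lam + mu)) (- del - mu) lam mu
    r _ _ _ rC);
  [|subst2_ring..].
rewrite (@lsub_lat2_nestr _ _ _ _ _ r rC Q (- del - (lam + mu)) lam lam mu l _ _ _ lC);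
  [|subst2_ring..].
by rewrite (lat2Dr rC).
Qed.

End Equations.

Section Cocycles.
Variables (K : fieldType) (R H : leibnizConformalAlgebra K).
Implicit Types z : cocycle_data R H.
Local Notation lam := (lvar K 2 0).
Local Notation mu := (lvar K 2 1).

Lemma at1E n (U V W : lmodType {poly K}) (B : U -> V -> {lpoly W[1]}) u
    (p : {mpoly {poly K}[n]}) x : conformal_bilinear B ->
  at1 (B u) p x = lat2 B p u%:l x.
Proof.
move=> BC; rewrite lat2.unlock lcon.unlock /at2 -lex.unlock -lcon.unlock lexC //.
move=> c v w; rewrite /at1 -lex.unlock -lsub.unlock; apply: lex_comb => [||| h].
- by apply: klinear_lsub; case: BC.
- by apply: klinear_lsub; case: BC.
- by apply: klinear_lsub; case: BC.
- by have [-> _ _ _] := BC; rewrite lsubD lsubZ psubst_lcst.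
Qed.

(** Conformal linearity of each [f a] is the rule for d in the right argument; compatibility with
    the module structure on conformal linear maps is the rule for d in the left one. *)
Lemma conformal_actionP (f : R -> H -> {lpoly H[1]}) :
  (forall a, conformal_linear (f a)) /\ hom_to_conformal_maps f <->
  conformal_bilinear f.
Proof.
split=> [[fC [fK fX]]|[f1 f2 f3 f4]]; first split.
- by move=> h c a b; exact: fK.
- by move=> a; case: (fC a).
- by move=> a h; exact: fX.
- by move=> a h; case: (fC a) => _; exact.
split; first by move=> a; split=> // h; exact: f4.
by split=> [c a b h|a h]; [exact: f1 | exact: f3].
Qed.

Lemma cocycleP z : nonabelian_cocycle z <->
  [/\ conformal_bilinear (cl z), conformal_bilinear (cr z), conformal_bilinear (cchi z)
    & defects_vanish (@lbr K R) (@lbr K H) (cl z) (bopp (cr z)) (cchi z)].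
Proof.
have bRC := @lbr_conformal K R; have bHC := @lbr_conformal K H.
split=> [[chiC [lD lH] [rD rH] i1 i2 ii iii iv]|[lC rC chiC [e1 e2 e3 e4 e5 e6 e7]]].
  have lC : conformal_bilinear (cl z).
    by apply/conformal_actionP; split=> // a; case: (lD a).
  have rC : conformal_bilinear (cr z).
    by apply/conformal_actionP; split=> // a; case: (rD a).
  split=> //.
  (* RHR and RHH come before the rest because HRR and HRH match (i) only modulo them. *)
  have RHR a h b :
      defectRHR (@lbr K R) (@lbr K H) (cl z) (bopp (cr z)) (cchi z) a h b = 0.
    by apply/(defectRHR_eq0 bRC bHC lC rC chiC);
      rewrite lat2.unlock lcon.unlock; apply: iii.
  have RHH a u v : defectRHH (@lbr K H) (cl z) a u v = 0.
    apply/defectRHH_eq0; case: (lD a) => _ /(_ u v).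
    by rewrite -lat2.unlock -lcon.unlock !at1E.
  split=> //.
  - move=> a b c; apply/(defectRRR_eq0 _ _ _ rC).
    by rewrite lat2.unlock lcon.unlock; apply: iv.
  - by move=> a b h; apply/defectRRH_eq0; rewrite lat2.unlock lcon.unlock; apply: ii.
  - move=> h a b; apply/(defectHRR_eq0 bRC bHC lC rC chiC (RHR a h b)).
    by rewrite lat2.unlock lcon.unlock; apply: i2.
  - move=> u a v; apply/(defectHRH_eq0 bHC lC rC (RHH a u v)).
    by rewrite lat2.unlock lcon.unlock; apply: i1.
  - move=> u v a; apply/(defectHHR_eq0 bHC rC); case: (rD a) => _ /(_ u v).
    by rewrite -lat2.unlock -lcon.unlock !at1E.
have [lL lH] := (conformal_actionP (cl z)).2 lC.
have [rL rH] := (conformal_actionP (cr z)).2 rC.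
split=> //.
- split=> // a; split=> // u v; rewrite -lat2.unlock -lcon.unlock !at1E //.
  exact: (defectRHH_eq0 _ _ _ _ _).1 (e5 _ _ _).
- split=> // a; split=> // u v; rewrite -lat2.unlock -lcon.unlock !at1E //.
  exact: (defectHHR_eq0 bHC rC _ _ _).1 (e7 _ _ _).
- move=> a u v; rewrite -lat2.unlock -lcon.unlock.
  exact: (defectHRH_eq0 bHC lC rC (e5 a u v)).1 (e6 _ _ _).
(* In (i) the outer r carries the first element of R, in HRR the last one; hence the exchanged
   names. *)
- move=> b a h; rewrite -lat2.unlock -lcon.unlock.
  exact: (defectHRR_eq0 bRC bHC lC rC chiC (e3 a h b)).1 (e4 _ _ _).
- move=> a b h; rewrite -lat2.unlock -lcon.unlock.
  exact: (defectRRH_eq0 _ _ _ _ _ _ _).1 (e2 _ _ _).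
- move=> a b h; rewrite -lat2.unlock -lcon.unlock.
  exact: (defectRHR_eq0 bRC bHC lC rC chiC _ _ _).1 (e3 _ _ _).
- move=> a b c; rewrite -lat2.unlock -lcon.unlock.
  exact: (defectRRR_eq0 _ _ _ rC _ _ _).1 (e1 _ _ _).
Qed.

End Cocycles.

(** * Cochains of degree one and the Maurer-Cartan equation on R x H *)

Section Cochains.
Variables (K : fieldType) (E : lmodType {poly K}).

Lemma set_arg_l (x y w : E) : set_arg (pair_arg x y) ord0 w = pair_arg w y.
Proof. by apply/ffunP => i; rewrite !ffunE; case: eqP. Qed.

Lemma set_arg_r (x y w : E) : set_arg (pair_arg x y) ord_max w = pair_arg x w.
Proof.
apply/ffunP => i; rewrite !ffunE; case: (i =P ord0) => [->//|/eqP i0].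
by case: eqP => // i1; case: i1; apply/val_inj; case: i i0 => [[|[|]]].
Qed.

Lemma pair_arg0 (x y : E) : pair_arg x y ord0 = x. Proof. by rewrite ffunE. Qed.

Lemma pair_arg1 (x y : E) : pair_arg x y ord_max = y. Proof. by rewrite ffunE. Qed.

Lemma is_cochainP (g : cochain E 1) : is_cochain g <-> conformal_bilinear (binary g).
Proof.
have I2 (i : 'I_2) : i = ord0 \/ i = ord_max.
  by case: i => [[|[|]]] // ?; [left | right]; apply/val_inj.
split=> [[gK gl gr]|[g1 g2 g3 g4]]; split.
- by move=> y c u v; have := gK (pair_arg 0 y) ord0 c u v; rewrite !set_arg_l.
- by move=> x c u v; have := gK (pair_arg x 0) ord_max c u v; rewrite !set_arg_r.
- move=> x y; have := gl (pair_arg x y) ord0 isT.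
  by rewrite set_arg_l pair_arg0.
- move=> x y; have := gr (pair_arg x y); rewrite set_arg_r pair_arg1 => gE.
  by rewrite /binary gE big_ord1.
- move=> a i c u v; rewrite -(pair_argE a); case: (I2 i) => ->.
    by rewrite !set_arg_l; apply: g1.
  by rewrite !set_arg_r; apply: g2.
- move=> a i i0; rewrite -(pair_argE a); case: (I2 i) i0 => -> // _.
  by rewrite set_arg_l pair_arg0; apply: g3.
- move=> a; rewrite -(pair_argE a) set_arg_r pair_arg1 big_ord1.
  exact: g4.
Qed.

(** Both degrees are odd, so the graded bracket is a symmetric sum. In particular [c,c] = 2 c.c, and
    the factor 1/2 in the Maurer-Cartan equation cancels as soon as 2 is invertible. *)
Lemma cbracket_binary (g t : cochain E 1) (a : {ffun 'I_3 -> E}) :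
  conformal_bilinear (binary g) -> conformal_bilinear (binary t) ->
  cbracket g t a =
  prod_bilinear (binary g) (binary t) (a ord0) (a (inord 1)) (a ord_max) +
  prod_bilinear (binary t) (binary g) (a ord0) (a (inord 1)) (a ord_max).
Proof.
move=> gC tC; rewrite -(graded_prod_binary a gC tC) -(graded_prod_binary a tC gC).
by rewrite /cbracket muln1 expr1 scaleN1r opprK.
Qed.

Definition triple_arg (x y w : E) : {ffun 'I_3 -> E} :=
  [ffun i => if i == ord0 then x else if i == ord_max then w else y].

Lemma triple_argE (x y w : E) :
  [/\ triple_arg x y w ord0 = x, triple_arg x y w (inord 1) = y
    & triple_arg x y w ord_max = w].
Proof. by rewrite !ffunE -!val_eqE /= inordK. Qed.

Lemma half_double (V : lmodType {poly K}) (x : {lpoly V[2]}) : 2%:R != 0 :> K ->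
  lcst 2 2%:R^-1 *: (x + x) = x.
Proof.
move=> n2; rewrite scalerDr -scalerDl /lcst -!raddfD /=.
by rewrite -mulr2n -[_ *+ 2]mulr_natr mulVf // -/(lcst 2 1) lcst1 scale1r.
Qed.

End Cochains.

Lemma lcoef0 (A : comNzRingType) n (V : lmodType A) k :
  lcoef k (0 : {lpoly V[n]}) = 0.
Proof. exact: monalg.mcoeff0. Qed.

Section Coefficients.
Variables (K : fieldType) (n : nat) (V W : lmodType {poly K}) (h : {linear V -> W}).

Lemma lcoef_lmp k (x : {lpoly V[n]}) : lcoef k (lmp h x) = h (lcoef k x).
Proof.
have lcoef_lmon (U : lmodType {poly K}) i (v : U) : lcoef k (lmon i v) = v *+ (i == k).
  exact: monalg.mcoeffU.
elim/lpoly_ind: x => [|i v x IH]; first by rewrite lmp0 !lcoef0 linear0.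
rewrite lmpD !lcoefD linearD IH lmonE lmpZ lmpC -!lmonE; congr (_ + _).
by rewrite [LHS]lcoef_lmon [in RHS]lcoef_lmon linearMn.
Qed.

Lemma lmp_eq0 (x : {lpoly V[n]}) : (forall k, h (lcoef k x) = 0) -> lmp h x = 0.
Proof.
by move=> hx; rewrite (lpolyE (lmp h x)) big1 // => k _; rewrite lcoef_lmp hx lmon0.
Qed.

End Coefficients.

Section MaurerCartan.
Variables (K : fieldType) (R H : leibnizConformalAlgebra K).
Local Notation E := (R * H)%type.

Definition inl0 (a : R) : E := (a, 0).
Definition inr0 (h : H) : E := (0, h).

Fact inl0_linear : linear inl0.
Proof. by move=> c a b; rewrite /inl0; congr pair; rewrite /= scaler0 addr0. Qed.
HB.instance Definition _ := GRing.isLinear.Build {poly K} R E _ inl0 inl0_linear.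

Fact inr0_linear : linear inr0.
Proof. by move=> c a b; rewrite /inr0; congr pair; rewrite /= scaler0 addr0. Qed.
HB.instance Definition _ := GRing.isLinear.Build {poly K} H E _ inr0 inr0_linear.

Lemma pair_sumE (x : E) : x = inl0 x.1 + inr0 x.2.
Proof. by case: x => a h; rewrite /inl0 /inr0; congr pair;
  rewrite /= ?addr0 ?add0r. Qed.

Lemma lpoly_pairE n (x : {lpoly E[n]}) :
  x = lmp inl0 (lmp fst x) + lmp inr0 (lmp snd x).
Proof.
elim/lpoly_gen_ind: x => [v|i x IH|x y IHx IHy].
- by rewrite !lmpC -lconD -pair_sumE.
- by rewrite !lmpZ -scalerDr -IH.
- by rewrite !lmpD addrACA -IHx -IHy.
Qed.

Definition pi_bracket : E -> E -> {lpoly E[1]} :=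
  sum_bracket inl0 inr0 fst snd (@lbr K R) (@lbr K H).

Definition cocycle_bracket (z : cocycle_data R H) : E -> E -> {lpoly E[1]} :=
  mixed_bracket inr0 fst snd (cl z) (bopp (cr z)) (cchi z).

Lemma binary_direct_sum : binary (@direct_sum_bracket K R H) = pi_bracket.
Proof.
apply/funext => x; apply/funext => y.
by rewrite /binary /direct_sum_bracket pair_arg0 pair_arg1
  /pi_bracket /sum_bracket /pullback lmp.unlock.
Qed.

Lemma binary_cocycle_to_MC z : binary (cocycle_to_MC z) = cocycle_bracket z.
Proof.
apply/funext => x; apply/funext => y.
rewrite /binary /cocycle_to_MC pair_arg0 pair_arg1 /cocycle_bracket /mixed_bracket.
rewrite /pullback -!lmpD /bopp lmp.unlock lsub.unlock.
by case: x y => a u [b v].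
Qed.

Lemma conformal_pi_bracket : conformal_bilinear pi_bracket.
Proof. by apply: conformal_sum_bracket; apply: lbr_conformal. Qed.

(** Stated for any [c] with the binary form of [z], to serve twice: for the image of a cocycle, and
    for a given Maurer-Cartan element whose triple [z] is not yet known to be a cocycle. *)
Lemma maurer_cartan_eqP z (c : cochain E 1) : 2%:R != 0 :> K ->
    conformal_bilinear (cl z) -> conformal_bilinear (cr z) ->
    conformal_bilinear (cchi z) ->
    binary c = cocycle_bracket z ->
  (forall a, dcochain c a + lcst (1 + 1) 2%:R^-1 *: cbracket c c a = 0) <->
  defects_vanish (@lbr K R) (@lbr K H) (cl z) (bopp (cr z)) (cchi z).
Proof.
move=> n2 lC rC chiC cE; have roC := conformal_bopp rC.
have cC : conformal_bilinear (cocycle_bracket z) by apply: conformal_mixed_bracket.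
have mcE a : dcochain c a + lcst (1 + 1) 2%:R^-1 *: cbracket c c a =
   mc_defect inl0 inr0 fst snd (@lbr K R) (@lbr K H) (cl z) (bopp (cr z)) (cchi z)
     (a ord0) (a (inord 1)) (a ord_max).
  rewrite /dcochain !cbracket_binary ?cE ?binary_direct_sum //;
    try exact: conformal_pi_bracket.
  by rewrite half_double.
apply: iff_trans (mc_defect_eq0 _ _ _ _ _ _ _ _ _ pair_sumE) => //;
  try exact: lbr_conformal.
split=> [D0 x y w|D0 a]; last by rewrite mcE D0.
have := D0 (triple_arg x y w); rewrite mcE.
by case: (triple_argE x y w) => -> -> ->.
Qed.

End MaurerCartan.

Lemma card_set2 (S : {set 'I_2}) : #|S| = ((ord0 \in S) + (ord_max \in S))%N.
Proof.
rewrite -sum1_card big_mkcond big_ord_recl big_ord1.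
have -> : lift ord0 ord0 = ord_max :> 'I_2 by apply/val_inj.
by do 2!case: (_ \in S).
Qed.

(** * Maurer-Cartan elements and cocycles *)

Section DegreeOne.
Variables (K : fieldType) (R H : leibnizConformalAlgebra K).
Local Notation E := (R * H)%type.
Local Notation inl0 := (@inl0 K R H).
Local Notation inr0 := (@inr0 K R H).
Implicit Types (c g : cochain E 1) (B : E -> E -> {lpoly E[1]}).

Lemma conformal0l (U V W : lmodType {poly K}) (B : U -> V -> {lpoly W[1]}) y :
  conformal_bilinear B -> B 0 y = 0.
Proof. by case=> B1 _ _ _; apply: klinear0 (B1 y). Qed.

Lemma conformal0r (U V W : lmodType {poly K}) (B : U -> V -> {lpoly W[1]}) x :
  conformal_bilinear B -> B x 0 = 0.
Proof. by case=> _ B2 _ _; apply: klinear0 (B2 x). Qed.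

(** The summands follow the order l, r, chi of [mixed_bracket], with the H x H part last. *)
Lemma conformal_pairE B x y : conformal_bilinear B ->
  B x y = B (inl0 x.1) (inr0 y.2) + B (inr0 x.2) (inl0 y.1)
          + B (inl0 x.1) (inl0 y.1) + B (inr0 x.2) (inr0 y.2).
Proof.
case=> B1 B2 _ _; rewrite {1}(pair_sumE x) {1}(pair_sumE y).
rewrite (klinearD (B1 _)) !(klinearD (B2 _)).
have regroup (V : zmodType) (a b c d : V) : a + b + (c + d) = b + c + a + d.
  by rewrite [LHS](AC (2*2) (2*3*1*4)).
exact: regroup.
Qed.

Lemma fst_coefP n (x : {lpoly E[n]}) : lmp fst x = 0 <-> forall k, (lcoef k x).1 = 0.
Proof.
split=> [x0 k|x0]; last exact: lmp_eq0.
by have := lcoef_lmp fst k x; rewrite x0 lcoef0.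
Qed.

(** An argument whose entries lie in R on [S] and in H off [S] equals the tuple of injections of its
    components, so vanishing need only be tested on such tuples. *)
Lemma in_CmnP m (g : cochain E 1) : (0 < m <= 2)%N ->
  in_Cmn m (2 - m) g <->
  [/\ conformal_bilinear (binary g), forall x y, lmp fst (binary g x y) = 0
    & forall (S : {set 'I_2}) x y,
        ((ord0 \in S) + (ord_max \in S) != m)%N ->
        binary g (if ord0 \in S then inl0 x.1 else inr0 x.2)
                 (if ord_max \in S then inl0 y.1 else inr0 y.2) = 0].
Proof.
move=> /andP[m0 m2]; split=> [[_ gC g1 gS]|[gC g1 gS]]; split=> //.
- exact/is_cochainP.
- by move=> x y; apply/fst_coefP => k; apply: g1.
- move=> S x y Sm; apply: (gS S); last by rewrite card_set2.
    move=> i iS; rewrite ffunE; case: (i =P ord0) iS => [->->//|/eqP i0].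
    by have -> : i = ord_max by [apply/val_inj; case: i i0 => [[|[|]]]] => ->.
  move=> i iS; rewrite ffunE; case: (i =P ord0) iS => [->/negPf->//|/eqP i0].
  by have -> : i = ord_max by [apply/val_inj; case: i i0 => [[|[|]]]] => /negPf->.
- by rewrite subnKC.
- exact/is_cochainP.
- by move=> a k; rewrite -(pair_argE a); apply/fst_coefP: k; apply: g1.
- move=> S a aS aNS; rewrite card_set2 => /gS gS0.
  rewrite -(pair_argE a) -[RHS](gS0 (a ord0) (a ord_max)) /binary;
    congr (g (pair_arg _ _)).
    rewrite (pair_sumE (a ord0)); case: ifPn => [/aS ->|/aNS ->].
      by rewrite linear0 addr0.
    by rewrite linear0 add0r.
  rewrite (pair_sumE (a ord_max)); case: ifPn => [/aS ->|/aNS ->].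
    by rewrite linear0 addr0.
  by rewrite linear0 add0r.
Qed.

End DegreeOne.

Section Bijection.
Variables (K : fieldType) (R H : leibnizConformalAlgebra K).
Local Notation E := (R * H)%type.
Local Notation inl0 := (@inl0 K R H).
Local Notation inr0 := (@inr0 K R H).
Implicit Types (c g : cochain E 1) (B : E -> E -> {lpoly E[1]}).

Lemma in_L1P c : in_L c <->
  [/\ conformal_bilinear (binary c), forall x y, lmp fst (binary c x y) = 0
    & forall u v, binary c (inr0 u) (inr0 v) = 0].
Proof.
have sumE (f : nat -> cochain E 1) a : \sum_(1 <= m < 3) f m a = f 1%N a + f 2%N a.
  by rewrite big_ltn // big_ltn // big_geq // addr0.
split=> [[f [fC cE]]|[cC c1 c2]].
  have [C1 F1 V1] := (@in_CmnP _ _ _ 1 _ isT).1 (fC 1%N isT).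
  have [C2 F2 V2] := (@in_CmnP _ _ _ 2 _ isT).1 (fC 2%N isT).
  have cB : binary c = fun x y => binary (f 1%N) x y + binary (f 2%N) x y.
    by apply/funext => x; apply/funext => y; rewrite /binary cE sumE.
  rewrite cB; split=> [|x y|u v]; first exact: conformal_bilinearD.
    by rewrite lmpD F1 F2 addr0.
  (* The empty set of R-positions has cardinal 0, which is neither 1 nor 2, so both components
     vanish on H x H. *)
  have := V1 finset.set0 (0, u) (0, v); have := V2 finset.set0 (0, u) (0, v).
  by rewrite !finset.in_set0 => -> // -> //; rewrite addr0.
pose B := binary c.
(* The projectors of E onto its summands split c: [B1] collects the two mixed parts and lies in
   C^(1,1), [B2] is the R x R part and lies in C^(2,0). *)
pose pl : {linear E -> E} := inl0 \o fst.
pose pr : {linear E -> E} := inr0 \o snd.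
pose B1 x y := pullback B pl pr idfun x y + pullback B pr pl idfun x y.
pose B2 := pullback B pl pl idfun.
pose f m : cochain E 1 := if m == 1%N then fun a => B1 (a ord0) (a ord_max)
                          else fun a => B2 (a ord0) (a ord_max).
have f1E : binary (f 1%N) = B1.
  by apply/funext => x; apply/funext => y; rewrite /binary /f /= pair_arg0 pair_arg1.
have f2E : binary (f 2%N) = B2.
  by apply/funext => x; apply/funext => y; rewrite /binary /f /= pair_arg0 pair_arg1.
have B1C : conformal_bilinear B1
  by apply: conformal_bilinearD; apply: conformal_pullback.
have B2C : conformal_bilinear B2 by apply: conformal_pullback.
have inl00 : inl0 0 = 0 by [].
have inr00 : inr0 0 = 0 by [].
have idE (X : {lpoly E[1]}) : lmp idfun X = X by apply: lmp_id.
exists f; split=> [[|[|[|//]]] // _|a].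
- apply/in_CmnP => //; rewrite f1E; split=> // [x y|S x y].
    by rewrite /B1 /pullback !idE lmpD !c1 addr0.
  rewrite /B1 /pullback; case: (ord0 \in S); case: (ord_max \in S) => //= _.
    by rewrite inr00 conformal0l // conformal0r // lmp0 addr0.
  by rewrite inl00 conformal0l // conformal0r // lmp0 addr0.
- apply/in_CmnP => //; rewrite f2E; split=> // [x y|S x y].
    by rewrite /B2 /pullback idE.
  rewrite /B2 /pullback; case: (ord0 \in S); case: (ord_max \in S) => //= _.
  + by rewrite inl00 conformal0r // lmp0.
  + by rewrite inl00 conformal0l // lmp0.
  + by rewrite inl00 conformal0l // lmp0.
rewrite sumE /f /= -{1}(pair_argE a) -/(binary c _ _) (conformal_pairE _ _ cC).
by rewrite c2 addr0 /B1 /B2 /pullback !idE.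
Qed.

Section Values.
Variable z : cocycle_data R H.
Hypotheses (lC : conformal_bilinear (cl z)) (rC : conformal_bilinear (cr z)).
Hypothesis chiC : conformal_bilinear (cchi z).

Let roC := conformal_bopp rC.

Lemma cocycle_bracketRH a h : cocycle_bracket z (inl0 a) (inr0 h) = lmp inr0 (cl z a h).
Proof.
rewrite /cocycle_bracket /mixed_bracket /pullback /=.
by rewrite (conformal0l _ roC) (conformal0r _ chiC) !lmp0 !addr0.
Qed.

Lemma cocycle_bracketHR h a :
  cocycle_bracket z (inr0 h) (inl0 a) = lmp inr0 (bopp (cr z) h a).
Proof.
rewrite /cocycle_bracket /mixed_bracket /pullback /=.
by rewrite (conformal0l _ lC) (conformal0l _ chiC) !lmp0 add0r addr0.
Qed.

Lemma cocycle_bracketRR a b :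
  cocycle_bracket z (inl0 a) (inl0 b) = lmp inr0 (cchi z a b).
Proof.
rewrite /cocycle_bracket /mixed_bracket /pullback /=.
by rewrite (conformal0l _ roC) (conformal0r _ lC) !lmp0 !add0r.
Qed.

Lemma cocycle_bracketHH u v : cocycle_bracket z (inr0 u) (inr0 v) = 0.
Proof.
rewrite /cocycle_bracket /mixed_bracket /pullback /=.
by rewrite (conformal0l _ lC) (conformal0r _ roC) (conformal0l _ chiC) !lmp0 !addr0.
Qed.

End Values.

Lemma lmp_inr_inj : injective (fun x : {lpoly H[1]} => lmp inr0 x).
Proof.
by apply: (can_inj (g := fun y => lmp snd y)) => x; exact: (@lmp_p2i2 _ _ _ inr0 snd).
Qed.

Lemma cocycle_MC_bijection : 2%:R != 0 :> K ->
  set_bij (@Z2nab K R H) (@MC K R H) (@cocycle_to_MC K R H).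
Proof.
move=> n2; split.
- move=> z /cocycleP[lC rC chiC D]; split; last first.
    exact: (maurer_cartan_eqP n2 lC rC chiC (binary_cocycle_to_MC z)).2 D.
  apply/in_L1P; rewrite binary_cocycle_to_MC; split=> [|x y|u v].
  + by apply: conformal_mixed_bracket => //; apply: conformal_bopp.
  + by rewrite /cocycle_bracket /mixed_bracket /pullback !lmpD !lmp_p1i2 ?addr0.
  + exact: cocycle_bracketHH.
- move=> z z' /set_mem/cocycleP[lC rC chiC _] /set_mem/cocycleP[lC' rC' chiC' _] zz'.
  have B : cocycle_bracket z = cocycle_bracket z' by rewrite -!binary_cocycle_to_MC zz'.
  have rE : bopp (cr z) = bopp (cr z').
    apply/funext => h; apply/funext => a; apply: lmp_inr_inj.
    by rewrite -!cocycle_bracketHR ?B.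
  have : cl z = cl z'.
    apply/funext => a; apply/funext => h; apply: lmp_inr_inj.
    by rewrite -!cocycle_bracketRH ?B.
  have : cr z = cr z'.
    by apply/funext => a; apply/funext => h; rewrite -(boppK (cr z)) rE boppK.
  have : cchi z = cchi z'.
    apply/funext => a; apply/funext => b; apply: lmp_inr_inj.
    by rewrite -!cocycle_bracketRR ?B.
  by case: (z) (z') => ? ? ? [? ? ?] /= -> -> ->.
- move=> c [/in_L1P[cC c1 c2] mc].
  (* The inverse map restricts c to pairs of summands and projects to H. The H x R component is r
     with subscript -d-lambda, so r is its [bopp]. *)
  pose ro := pullback (binary c) inr0 inl0 snd.
  pose z := CocycleData (pullback (binary c) inl0 inr0 snd) (bopp ro)
                        (pullback (binary c) inl0 inl0 snd).
  have roC : conformal_bilinear ro by apply: conformal_pullback.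
  have lC : conformal_bilinear (cl z) by apply: conformal_pullback.
  have rC : conformal_bilinear (cr z) by apply: conformal_bopp.
  have chiC : conformal_bilinear (cchi z) by apply: conformal_pullback.
  have cE : binary c = cocycle_bracket z.
    apply/funext => x; apply/funext => y; rewrite (conformal_pairE _ _ cC) c2 addr0.
    (* c takes values in H, so projecting to H loses nothing. *)
    have inrK u v : lmp inr0 (lmp snd (binary c u v)) = binary c u v.
      by rewrite [RHS]lpoly_pairE c1 lmp0 add0r.
    rewrite /cocycle_bracket /mixed_bracket.
    apply: f_equal2; first apply: f_equal2.
    + by rewrite /pullback inrK.
    + by rewrite {1}/pullback boppK /ro /pullback inrK.
    + by rewrite /pullback inrK.
  exists z; first by apply/cocycleP; split=> //;
    apply/(maurer_cartan_eqP n2 lC rC chiC cE).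
  apply/funext => a; rewrite -(pair_argE a).
  have := congr1 (fun B => B (a ord0) (a ord_max)) (binary_cocycle_to_MC z).
  by rewrite -cE.
Qed.

End Bijection.

Theorem corollary4p5 (T : realType) (R H : leibnizConformalAlgebra T[i])
    (fgR : finitely_generated R) (fgH : finitely_generated H) :
  set_bij (@Z2nab T[i] R H) (@MC T[i] R H) (@cocycle_to_MC T[i] R H).
Proof. by apply: cocycle_MC_bijection; rewrite Num.Theory.pnatr_eq0. Qed.
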